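(* Let $a>0$, $b>0$. For $\beta>0$ let $G_\beta:\mathbb{R}^2\to\mathbb{R}^2$, $G_\beta(x,y)=\left(y,-x+\frac{y}{\beta+y^2}\right)$, and let $G_{b,a}=G_b\circ G_a$. Let $V_{b,a}(x,y)=ax^2+by^2-xy+x^2y^2$, which is a first integral of $G_{b,a}$. \begin{itemize} \item[(a)] If $ab\ge 1/4$, then the origin is the unique fixed point of $G_{b,a}$ and it is of elliptic type. For every $h>0$ the set $\{V_{b,a}(x,y)=h\}$ surrounds the origin, is diffeomorphic to a circle and is invariant under $G_{b,a}$, and the restriction of $G_{b,a}$ to it is conjugated to a rotation. \item[(b)] If $ab<1/4$, then: \begin{itemize} \item[(i)] The origin is a hyperbolic saddle of $G_{b,a}$. The set $\{V_{b,a}(x,y)=0\}\setminus\{(0,0)\}$ coincides with the stable and unstable manifolds of the saddle and consists of two curves diffeomorphic to the real line; each of them is invariant under $G_{b,a}$ and the restriction of $G_{b,a}$ to each is conjugated to a translation. \item[(ii)] For every $h>0$ the set $\{V_{b,a}(x,y)=h\}$ is diffeomorphic to a circle surrounding the set $\{V_{b,a}\le 0\}$; it is invariant under $G_{b,a}$ and the restriction of $G_{b,a}$ to it is conjugated to a rotation. \item[(iii)] The points $P_{\pm}=\left(\pm\sqrt{-b+\frac12\sqrt{b/a}},\ \pm\sqrt{-a+\frac12\sqrt{a/b}}\right)$ are fixed points of $G_{b,a}$ of elliptic type. \item[(iv)] For every $h<0$ with $h\neq h_{\min}:=-\frac14-ab+\sqrt{ab}$ for which the set $\{V_{b,a}(x,y)=h\}$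 is nonempty, this set is diffeomorphic to two circles surrounding $P_+$ and $P_-$ respectively; each of these circles is invariant under $G_{b,a}$ and the restriction of $G_{b,a}$ to each is conjugated to a rotation of the circle. \end{itemize} \end{itemize}
   Context: A fixed point is of elliptic type if the eigenvalues of the differential of the map at it are complex conjugate of modulus one. $V_{b,a}(P_\pm)=h_{\min}$, and $\{V_{b,a}<h_{\min}\}$ is empty. *)

(* Defs.v *)
From Stdlib Require Import Reals Lra.
From Coquelicot Require Import Coquelicot.
Open Scope R_scope.

Definition pt := (R * R)%type.
Definition origin : pt := (0, 0).

Definition Gbeta (beta : R) (p : pt) : pt :=
  (snd p, - fst p + snd p / (beta + snd p ^ 2)).
Definition Gba (a b : R) (p : pt) : pt := Gbeta b (Gbeta a p).

Definition Vba (a b : R) (p : pt) : R :=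
  a * fst p ^ 2 + b * snd p ^ 2 - fst p * snd p + fst p ^ 2 * snd p ^ 2.

Definition level (a b h : R) : pt -> Prop := fun p => Vba a b p = h.

Definition dist2 (p q : pt) : R :=
  sqrt ((fst p - fst q) ^ 2 + (snd p - snd q) ^ 2).

(* ---- Linearization: the differential l of G at p (Frechet, via Coquelicot's
   filterdiff on the normed module R*R); its matrix has columns l(1,0), l(0,1). *)
Definition mtrace (l : pt -> pt) : R := fst (l (1, 0)) + snd (l (0, 1)).
Definition mdet (l : pt -> pt) : R :=
  fst (l (1, 0)) * snd (l (0, 1)) - fst (l (0, 1)) * snd (l (1, 0)).

(* Eigenvalues (with multiplicity) are mu1, mu2 : the characteristic polynomial
   z^2 - tr z + det factors as (z - mu1)(z - mu2) over C. *)
Definition eigenvalues_are (l : pt -> pt) (mu1 mu2 : C) : Prop :=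
  forall z : C,
    Cplus (Cminus (Cmult z z) (Cmult (RtoC (mtrace l)) z)) (RtoC (mdet l))
    = Cmult (Cminus z mu1) (Cminus z mu2).

Definition elliptic_fixed (G : pt -> pt) (p : pt) : Prop :=
  G p = p /\
  exists l : pt -> pt, filterdiff G (locally p) l /\
    exists mu : C, Cmod mu = 1 /\ eigenvalues_are l mu (Cconj mu).

Definition hyperbolic_saddle (G : pt -> pt) (p : pt) : Prop :=
  G p = p /\
  exists l : pt -> pt, filterdiff G (locally p) l /\
    exists mu1 mu2 : R, Rabs mu1 < 1 /\ 1 < Rabs mu2 /\
      eigenvalues_are l (RtoC mu1) (RtoC mu2).

Definition stable_set (G : pt -> pt) (p : pt) : pt -> Prop := fun q =>
  forall eps, 0 < eps -> exists N, forall n, (N <= n)%nat ->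
    dist2 (Nat.iter n G q) p < eps.
Definition unstable_set (G : pt -> pt) (p : pt) : pt -> Prop := fun q =>
  exists s : nat -> pt, s O = q /\ (forall n, G (s (S n)) = s n) /\
    forall eps, 0 < eps -> exists N, forall n, (N <= n)%nat -> dist2 (s n) p < eps.

Definition smooth_fun (f : R -> R) : Prop :=
  forall (n : nat) (x : R), ex_derive (Derive_n f n) x.
Definition smooth_curve (g : R -> pt) : Prop :=
  smooth_fun (fun t => fst (g t)) /\ smooth_fun (fun t => snd (g t)).
Definition regular_curve (g : R -> pt) : Prop :=
  forall t, Derive (fun s => fst (g s)) t <> 0 \/ Derive (fun s => snd (g s)) t <> 0.
Definition cont_curve (g : R -> pt) : Prop :=
  continuity (fun t => fst (g t)) /\ continuity (fun t => snd (g t)).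
Definition image_is (g : R -> pt) (S : pt -> Prop) : Prop :=
  forall p, S p <-> exists t, g t = p.
Definition periodic1_inj (g : R -> pt) : Prop :=
  (forall t, g (t + 1) = g t) /\
  (forall s t, 0 <= s < 1 -> 0 <= t < 1 -> g s = g t -> s = t).
Definition inverse_continuous (g : R -> pt) : Prop :=
  forall t eps, 0 < eps -> exists delta, 0 < delta /\
    forall s, dist2 (g s) (g t) < delta -> Rabs (s - t) < eps.

Definition diffeo_circle (S : pt -> Prop) : Prop :=
  exists g : R -> pt, smooth_curve g /\ regular_curve g /\ periodic1_inj g /\
    image_is g S.
Definition diffeo_line (S : pt -> Prop) : Prop :=
  exists g : R -> pt, smooth_curve g /\ regular_curve g /\
    (forall s t, g s = g t -> s = t) /\ inverse_continuous g /\ image_is g S.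

Definition invariant (G : pt -> pt) (S : pt -> Prop) : Prop :=
  forall p, S p -> S (G p).

Definition conj_rotation (G : pt -> pt) (S : pt -> Prop) : Prop :=
  exists psi : R -> pt, cont_curve psi /\ periodic1_inj psi /\ image_is psi S /\
    exists theta : R, forall t, G (psi t) = psi (t + theta).
Definition conj_translation (G : pt -> pt) (S : pt -> Prop) : Prop :=
  exists psi : R -> pt, cont_curve psi /\ (forall s t, psi s = psi t -> s = t) /\
    inverse_continuous psi /\ image_is psi S /\
    exists tau : R, forall t, G (psi t) = psi (t + tau).

(* C surrounds p: p is not on C and lies in a bounded connected component of
   R^2 \ C, i.e. paths from p avoiding C stay bounded. *)
Definition surrounds_pt (Cv : pt -> Prop) (p : pt) : Prop :=
  ~ Cv p /\ exists M : R, forall sigma : R -> pt, cont_curve sigma ->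
    sigma 0 = p -> M <= dist2 (sigma 1) origin ->
    exists t, 0 <= t <= 1 /\ Cv (sigma t).
Definition surrounds (Cv A : pt -> Prop) : Prop :=
  forall p, A p -> surrounds_pt Cv p.

Definition hmin (a b : R) : R := - / 4 - a * b + sqrt (a * b).
Definition Pfix_plus (a b : R) : pt :=
  (sqrt (- b + / 2 * sqrt (b / a)), sqrt (- a + / 2 * sqrt (a / b))).
Definition Pfix_minus (a b : R) : pt :=
  (- sqrt (- b + / 2 * sqrt (b / a)), - sqrt (- a + / 2 * sqrt (a / b))).

(* Main.v *)
(* The symmetric biquadratic [Vba a b] is quadratic in each variable, and each
   [Gbeta] swaps the two roots; it also has Jacobian 1, so it carries orbits of
   the Hamiltonian field of [Vba a b] to orbits of the field of [Vba b a].  Hence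
   [Gba a b] commutes with the Hamiltonian flow of [Vba a b]: on an invariant
   curve covered by a single orbit it is a time shift, i.e. a rotation on closed
   orbits and a translation on homoclinic ones.  Each component of a level set is
   exhibited as one orbit by solving [Vba = h] for [x]: the discriminant in [y]
   factors as [4b (Y^2 - y^2) (y^2 + c)] for [h > 0], which gives
   [y = Y sin t]; as [4b (r^2 - (y^2 - m)^2)] for [h < 0], which gives
   [y^2 = m + r cos t]; and [y = Y / cosh (L t)] for [h = 0].  The angle becomes
   Hamiltonian time by a one-dimensional change of variable, and smoothness
   follows because the field is polynomial. *)

Require Import Defs.
From Stdlib Require Import Reals Lra IndefiniteDescription.
From Coquelicot Require Import Coquelicot.
Open Scope R_scope.

(** The flow of [Vba a b] is never constructed: orbits exist because they are given by formulas, and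
    only uniqueness is proved. The field is cubic, hence not globally Lipschitz, so uniqueness is
    stated for bounded orbits; the bound comes from [Vba + 1/4 = a x^2 + b y^2 + (x y - 1/2)^2],
    which makes every sublevel set bounded. Commutation with the flow becomes a comparison of two
    orbits, [Gba (g t)] and [g (t + tau)], that agree at time 0. Solving for [x] by a square root
    would force a choice of branch and a gluing at the turning points. Taking [Vx] itself, with its
    sign, as the companion of [y] avoids both. On the zero level the shift [tau] must be nonzero for
    iterates to reach the origin: a zero shift would create a second fixed point on that level. *)

Local Notation R2 := (prod_NormedModule R_AbsRing R_NormedModule R_NormedModule).
Local Notation R2top := (prod_UniformSpace R_UniformSpace R_UniformSpace).

Ltac derive_rewrite :=
  repeat match goal with
  | H : is_derive ?f ?t ?l |- context [Derive _ ?t] =>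
      replace (Derive (fun x => f x) t) with l
        by (symmetry; exact (is_derive_unique _ _ _ H)); clear H
  end.

Ltac derive_by H :=
  match goal with |- is_derive _ _ ?m =>
    match type of H with is_derive _ _ ?l => replace m with l; [ exact H | ] end
  end.

(** * Orbits of the Hamiltonian field *)

Definition Vx (a b : R) (p : pt) : R :=
  2 * (a + snd p ^ 2) * fst p - snd p.
Definition Vy (a b : R) (p : pt) : R :=
  2 * (b + fst p ^ 2) * snd p - fst p.

(* The factor [k] rescales time, so that closed orbits can be given period 1. *)
Definition orbit (a b k : R) (g : R -> pt) : Prop :=
  forall t, is_derive (fun s => fst (g s)) t (- k * Vy a b (g t)) /\
            is_derive (fun s => snd (g s)) t (k * Vx a b (g t)).

Lemma is_derive_Gbeta_snd a (x y : R -> R) t dx dy : 0 < a ->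
  is_derive x t dx -> is_derive y t dy ->
  is_derive (fun s => - x s + y s / (a + y s ^ 2)) t
    (- dx + (a - y t ^ 2) / (a + y t ^ 2) ^ 2 * dy).
Proof.
  intros ha Hx Hy. assert (0 < a + y t * y t) by nra.
  auto_derive.
  - repeat split; try (eexists; eassumption). simpl; nra.
  - derive_rewrite. field. simpl; nra.
Qed.

Lemma is_derive_sum_sqr (x1 x2 y1 y2 : R -> R) t dx1 dx2 dy1 dy2 :
  is_derive x1 t dx1 -> is_derive x2 t dx2 -> is_derive y1 t dy1 -> is_derive y2 t dy2 ->
  is_derive (fun s => (x1 s - x2 s) ^ 2 + (y1 s - y2 s) ^ 2) t
    (2 * (x1 t - x2 t) * (dx1 - dx2) + 2 * (y1 t - y2 t) * (dy1 - dy2)).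
Proof.
  intros. auto_derive.
  - repeat split; try (eexists; eassumption).
  - derive_rewrite. ring.
Qed.

(** The new coordinate [- x + y / (a + y ^ 2)] is the other root of [Vba a b = h] as a quadratic in
    [x], and the derivatives of a quadratic at its two roots are opposite. Hence [Vy b a] at the
    image is [- Vx a b], and the old equation for [y] is the new one for the first coordinate. *)
Lemma orbit_Gbeta a b k g : 0 < a ->
  orbit a b k g -> orbit b a k (fun t => Gbeta a (g t)).
Proof.
  intros ha Hg t. destruct (Hg t) as [H1 H2]. split.
  - apply is_derive_ext with (fun s => snd (g s)); [ reflexivity | ].
    replace (- k * Vy b a (Gbeta a (g t))) with (k * Vx a b (g t)); [ exact H2 | ].
    unfold Vx, Vy, Gbeta; simpl; field; nra.
  - replace (k * Vx b a (Gbeta a (g t))) with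
      (- (- k * Vy a b (g t)) + (a - snd (g t) ^ 2) / (a + snd (g t) ^ 2) ^ 2 * (k * Vx a b (g t)))
      by (unfold Vx, Vy, Gbeta; simpl; field; nra).
    now apply (is_derive_Gbeta_snd a (fun s => fst (g s)) (fun s => snd (g s))).
Qed.

Lemma orbit_Gba a b k g : 0 < a -> 0 < b ->
  orbit a b k g -> orbit a b k (fun t => Gba a b (g t)).
Proof.
  intros ha hb Hg. apply (orbit_Gbeta b a k (fun t => Gbeta a (g t)) hb).
  now apply orbit_Gbeta.
Qed.

Lemma orbit_shift a b k tau g :
  orbit a b k g -> orbit a b k (fun t => g (t + tau)).
Proof.
  intros Hg t. destruct (Hg (t + tau)) as [H1 H2].
  assert (D : is_derive (fun s : R => s + tau) t 1) by (auto_derive; trivial; ring).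
  split.
  - replace (- k * _) with (scal 1 (- k * Vy a b (g (t + tau))))
      by (unfold scal; simpl; unfold mult; simpl; ring).
    exact (is_derive_comp (fun s => fst (g s)) _ _ _ _ H1 D).
  - replace (k * _) with (scal 1 (k * Vx a b (g (t + tau))))
      by (unfold scal; simpl; unfold mult; simpl; ring).
    exact (is_derive_comp (fun s => snd (g s)) _ _ _ _ H2 D).
Qed.

(** * Uniqueness of bounded orbits *)

Lemma is_derive_nonpos_le (f df : R -> R) (s t : R) :
  (forall u, is_derive f u (df u)) -> (forall u, df u <= 0) -> s <= t -> f t <= f s.
Proof.
  intros Hd Hle Hst.
  destruct (MVT_gen f s t df) as [c [_ Hc]].
  - intros; apply Hd.
  - intros u _. apply continuity_pt_filterlim.
    apply (ex_derive_continuous (V := R_NormedModule)). eexists; apply Hd.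
  - specialize (Hle c). nra.
Qed.

(** [N exp (- L t)] is nonincreasing, which settles the times after [t0]; [N exp (L t)] is
    nondecreasing, which settles the times before it. *)
Lemma gronwall_zero (N dN : R -> R) (L t0 : R) :
  (forall t, is_derive N t (dN t)) -> (forall t, 0 <= N t) ->
  (forall t, Rabs (dN t) <= L * N t) -> N t0 = 0 -> forall t, N t = 0.
Proof.
  intros Hd Hpos Hb H0 t.
  assert (HD : forall t, ex_derive N t) by (intro; eexists; apply Hd).
  assert (HU : forall t, Derive N t = dN t) by (intro; apply is_derive_unique, Hd).
  assert (Hb1 : forall t, dN t <= L * N t /\ - dN t <= L * N t).
  { intro u. specialize (Hb u). unfold Rabs in Hb. destruct (Rcase_abs (dN u)); lra. }
  apply Rle_antisym; [ | apply Hpos ].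
  destruct (Rle_dec t0 t) as [Ht | Ht].
  - assert (E : N t * exp (- L * t) <= N t0 * exp (- L * t0)).
    { apply (is_derive_nonpos_le (fun u => N u * exp (- L * u))
        (fun u => (dN u - L * N u) * exp (- L * u))); trivial.
      - intro u. auto_derive; [ apply HD | ].
        rewrite HU. ring.
      - intro u. destruct (Hb1 u). pose proof (exp_pos (- L * u)). nra. }
    pose proof (exp_pos (- L * t)). rewrite H0 in E. nra.
  - assert (E : - (N t0 * exp (L * t0)) <= - (N t * exp (L * t))).
    { apply (is_derive_nonpos_le (fun u => - (N u * exp (L * u)))
        (fun u => - ((dN u + L * N u) * exp (L * u)))); [ | | lra ].
      - intro u. auto_derive; [ apply HD | ].
        rewrite HU. ring.
      - intro u. destruct (Hb1 u). pose proof (exp_pos (L * u)). nra. }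
    pose proof (exp_pos (L * t)). rewrite H0 in E. nra.
Qed.

Definition bounded_by (K : R) (p : pt) : Prop :=
  Rabs (fst p) <= K /\ Rabs (snd p) <= K.

(** Each mixed term obeys [2 X u v <= M (u ^ 2 + v ^ 2)] when [|X| <= M]. This bounds the derivative
    of the squared distance between two orbits. *)
Lemma quad_form_bound (A B C D M u v : R) :
  Rabs A <= M -> Rabs B <= M -> Rabs C <= M -> Rabs D <= M ->
  Rabs (A * u ^ 2 + B * u * v + C * u * v + D * v ^ 2) <= 2 * M * (u ^ 2 + v ^ 2).
Proof.
  intros HA HB HC HD.
  apply Rabs_le_between in HA, HB, HC, HD. apply Rabs_le_between.
  pose proof (pow2_ge_0 u) as U. pose proof (pow2_ge_0 v) as V.
  pose proof (pow2_ge_0 (u + v)) as S. pose proof (pow2_ge_0 (u - v)) as T.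
  assert (I : forall X, - M <= X <= M ->
    - M * u ^ 2 - M * v ^ 2 <= 2 * (X * u * v) <= M * u ^ 2 + M * v ^ 2).
  { intros X HX.
    assert (0 <= (M + X) * (u + v) ^ 2) by (apply Rmult_le_pos; lra).
    assert (0 <= (M - X) * (u - v) ^ 2) by (apply Rmult_le_pos; lra).
    assert (0 <= (M + X) * (u - v) ^ 2) by (apply Rmult_le_pos; lra).
    assert (0 <= (M - X) * (u + v) ^ 2) by (apply Rmult_le_pos; lra).
    split; lra. }
  pose proof (I B HB). pose proof (I C HC).
  assert (0 <= (M - A) * u ^ 2) by (apply Rmult_le_pos; lra).
  assert (0 <= (M + A) * u ^ 2) by (apply Rmult_le_pos; lra).
  assert (0 <= (M - D) * v ^ 2) by (apply Rmult_le_pos; lra).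
  assert (0 <= (M + D) * v ^ 2) by (apply Rmult_le_pos; lra).
  split; lra.
Qed.

Lemma orbit_unique a b k K g1 g2 t0 : 0 < a -> 0 < b ->
  orbit a b k g1 -> orbit a b k g2 ->
  (forall t, bounded_by K (g1 t)) -> (forall t, bounded_by K (g2 t)) ->
  g1 t0 = g2 t0 -> forall t, g1 t = g2 t.
Proof.
  intros ha hb O1 O2 B1 B2 E0 t.
  pose (u := fun t => fst (g1 t) - fst (g2 t)).
  pose (v := fun t => snd (g1 t) - snd (g2 t)).
  assert (HN : u t ^ 2 + v t ^ 2 = 0).
  (* Subtracting the two fields and factoring out the coordinate differences gives
     [u' = k (A u + B v)] and [v' = k (C u + D v)]; on bounded orbits all four coefficients stay
     below [1 + 2 a + 2 b + 4 K ^ 2] in absolute value. *)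
  { pose (A := fun t => 1 - 2 * snd (g2 t) * (fst (g1 t) + fst (g2 t))).
    pose (B := fun t => - (2 * b + 2 * fst (g1 t) ^ 2)).
    pose (C := fun t => 2 * a + 2 * snd (g1 t) ^ 2).
    pose (D := fun t => 2 * fst (g2 t) * (snd (g1 t) + snd (g2 t)) - 1).
    apply (gronwall_zero (fun t => u t ^ 2 + v t ^ 2)
      (fun t => 2 * k * (A t * u t ^ 2 + B t * u t * v t + C t * u t * v t + D t * v t ^ 2))
      (4 * Rabs k * (1 + 2 * a + 2 * b + 4 * K ^ 2)) t0).
    - intro s. destruct (O1 s) as [X1 Y1]. destruct (O2 s) as [X2 Y2].
      pose proof (is_derive_sum_sqr _ _ _ _ _ _ _ _ _ X1 X2 Y1 Y2) as HD.
      derive_by HD.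
      unfold A, B, C, D, u, v, Vx, Vy. ring.
    - intro s. apply Rplus_le_le_0_compat; apply pow2_ge_0.
    - intro s. rewrite Rabs_mult, Rabs_mult, (Rabs_pos_eq 2) by lra.
      destruct (B1 s) as [p1 q1]. destruct (B2 s) as [p2 q2].
      apply Rabs_le_between in p1, q1, p2, q2.
      assert (0 <= K) by lra.
      assert (fst (g1 s) ^ 2 <= K ^ 2) by nra.
      assert (snd (g1 s) ^ 2 <= K ^ 2) by nra.
      assert (BD : forall x y z, - K <= x <= K -> - K <= y <= K -> - K <= z <= K ->
         - (4 * K ^ 2) <= 2 * x * (y + z) <= 4 * K ^ 2) by (intros; split; nra).
      assert (Q := quad_form_bound (A s) (B s) (C s) (D s)
        (1 + 2 * a + 2 * b + 4 * K ^ 2) (u s) (v s)).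
      enough (Rabs (A s * u s ^ 2 + B s * u s * v s + C s * u s * v s + D s * v s ^ 2)
        <= 2 * (1 + 2 * a + 2 * b + 4 * K ^ 2) * (u s ^ 2 + v s ^ 2))
        by (pose proof (Rabs_pos k); nra).
      apply Q; apply Rabs_le_between; unfold A, B, C, D.
      + pose proof (BD _ _ _ q2 p1 p2). lra.
      + nra.
      + nra.
      + pose proof (BD _ _ _ p2 q1 q2). lra.
    - unfold u, v. rewrite E0. ring. }
  pose proof (pow2_ge_0 (u t)). pose proof (pow2_ge_0 (v t)).
  assert (Hu : u t = 0) by (apply Rsqr_eq_0; unfold Rsqr; lra).
  assert (Hv : v t = 0) by (apply Rsqr_eq_0; unfold Rsqr; lra).
  unfold u in Hu. unfold v in Hv. apply injective_projections; lra.
Qed.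

(** * Boundedness of the sublevel sets *)

Lemma level_coercive a b p :
  a * fst p ^ 2 + b * snd p ^ 2 <= Vba a b p + / 4.
Proof.
  unfold Vba. pose proof (pow2_ge_0 (fst p * snd p - / 2)). nra.
Qed.

Lemma level_bounded a b h : 0 < a -> 0 < b ->
  exists K, forall p, Vba a b p <= h -> bounded_by K p.
Proof.
  (* The quotients bound [x ^ 2] and [y ^ 2]; the inequality [|x| <= 1 + x ^ 2] then replaces square
     roots. *)
  intros ha hb. exists (1 + (Rabs h + 1) / a + (Rabs h + 1) / b).
  intros p Hp. pose proof (level_coercive a b p) as C.
  pose proof (Rle_abs h). pose proof (Rabs_pos h).
  set (A := (Rabs h + 1) / a). set (B := (Rabs h + 1) / b).
  assert (HA : a * A = Rabs h + 1) by (unfold A; field; lra).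
  assert (HB : b * B = Rabs h + 1) by (unfold B; field; lra).
  assert (0 < A) by (unfold A; apply Rdiv_lt_0_compat; lra).
  assert (0 < B) by (unfold B; apply Rdiv_lt_0_compat; lra).
  assert (0 <= b * snd p ^ 2) by (pose proof (pow2_ge_0 (snd p)); nra).
  assert (0 <= a * fst p ^ 2) by (pose proof (pow2_ge_0 (fst p)); nra).
  fold A B.
  assert (fst p ^ 2 <= A) by (apply (Rmult_le_reg_l a); lra).
  assert (snd p ^ 2 <= B) by (apply (Rmult_le_reg_l b); lra).
  assert (Q : forall x, - (1 + x ^ 2) <= x <= 1 + x ^ 2).
  { intro x. pose proof (pow2_ge_0 (x + 1)). pose proof (pow2_ge_0 (x - 1)).
    pose proof (pow2_ge_0 x). split; lra. }
  pose proof (Q (fst p)). pose proof (Q (snd p)).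
  split; apply Rabs_le_between; lra.
Qed.

(* Polynomials in [x], [y] are kept as syntax so that differentiation along an
   orbit, [tder], can be iterated: this gives all derivatives of an orbit. *)
Inductive term : Type :=
  | Cst (c : R) | X | Y | Add (e f : term) | Mul (e f : term).

Fixpoint teval (e : term) (p : pt) : R :=
  match e with
  | Cst c => c
  | X => fst p
  | Y => snd p
  | Add e f => teval e p + teval f p
  | Mul e f => teval e p * teval f p
  end.

Fixpoint tder (a b k : R) (e : term) : term :=
  match e with
  | Cst _ => Cst 0
  | X => Mul (Cst (- k))
           (Add (Mul (Mul (Cst 2) (Add (Cst b) (Mul X X))) Y) (Mul (Cst (-1)) X))
  | Y => Mul (Cst k)
           (Add (Mul (Mul (Cst 2) (Add (Cst a) (Mul Y Y))) X) (Mul (Cst (-1)) Y))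
  | Add e f => Add (tder a b k e) (tder a b k f)
  | Mul e f => Add (Mul (tder a b k e) f) (Mul e (tder a b k f))
  end.

Lemma is_derive_teval a b k g e t : orbit a b k g ->
  is_derive (fun s => teval e (g s)) t (teval (tder a b k e) (g t)).
Proof.
  intro Hg. induction e; simpl.
  - apply (is_derive_const (V := R_NormedModule)).
  - destruct (Hg t) as [H _]. unfold Vy in H.
    derive_by H. ring.
  - destruct (Hg t) as [_ H]. unfold Vx in H.
    derive_by H. ring.
  - apply (is_derive_plus (V := R_NormedModule)); assumption.
  - apply (is_derive_mult (K := R_AbsRing)); trivial. intros; apply Rmult_comm.
Qed.

Lemma smooth_teval a b k g e : orbit a b k g -> smooth_fun (fun s => teval e (g s)).
Proof.
  intros Hg n.
  assert (H : forall t, Derive_n (fun s => teval e (g s)) n t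
                        = teval (Nat.iter n (tder a b k) e) (g t)).
  { induction n as [ | n IH ]; intro t; [ reflexivity | ].
    simpl. rewrite (Derive_ext _ _ t IH). apply is_derive_unique.
    now apply is_derive_teval. }
  intro t. apply ex_derive_ext with (fun s => teval (Nat.iter n (tder a b k) e) (g s)).
  - intro; symmetry; apply H.
  - eexists. now apply is_derive_teval.
Qed.

Lemma orbit_smooth a b k g : orbit a b k g -> smooth_curve g.
Proof.
  intro Hg. split.
  - exact (smooth_teval a b k g X Hg).
  - exact (smooth_teval a b k g Y Hg).
Qed.

Lemma orbit_cont a b k g : orbit a b k g -> cont_curve g.
Proof.
  intro Hg; split; intro t; apply continuity_pt_filterlim;
    apply (ex_derive_continuous (V := R_NormedModule)); destruct (Hg t) as [H1 H2].
  - eexists; exact H1.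
  - eexists; exact H2.
Qed.

(* A zero velocity would make the orbit constant, by uniqueness. *)
Lemma orbit_regular a b k K g u v : 0 < a -> 0 < b -> orbit a b k g ->
  (forall t, bounded_by K (g t)) -> g u <> g v -> regular_curve g.
Proof.
  intros ha hb Hg HK Huv t.
  destruct (Req_dec (Derive (fun s => fst (g s)) t) 0) as [D1 | D1]; [ | now left ].
  destruct (Req_dec (Derive (fun s => snd (g s)) t) 0) as [D2 | D2]; [ | now right ].
  exfalso. apply Huv.
  destruct (Hg t) as [H1 H2].
  assert (E1 : Derive (fun s => fst (g s)) t = _) by exact (is_derive_unique _ _ _ H1).
  assert (E2 : Derive (fun s => snd (g s)) t = _) by exact (is_derive_unique _ _ _ H2).
  rewrite D1 in E1. rewrite D2 in E2.
  assert (C : forall s, g s = g t).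
  { apply (orbit_unique a b k K g (fun _ => g t) t); trivial.
    intro s. rewrite <- E1, <- E2.
    split; apply (is_derive_const (V := R_NormedModule)). }
  now rewrite (C u), (C v).
Qed.

(** * The action of [Gba] on a curve covered by one orbit *)

Lemma Vba_Gbeta a b p : 0 < a -> Vba b a (Gbeta a p) = Vba a b p.
Proof. intro ha. unfold Vba, Gbeta; simpl; field; nra. Qed.

Lemma Vba_Gba a b p : 0 < a -> 0 < b -> Vba a b (Gba a b p) = Vba a b p.
Proof. intros ha hb. unfold Gba. now rewrite Vba_Gbeta, Vba_Gbeta. Qed.

(** [tau] is a time at which [g] reaches the image of [g 0]. Both sides are then orbits with the
    same [k] in one bounded sublevel set, equal at time 0, so uniqueness identifies them. *)
Lemma Gba_orbit_shift a b k h g S : 0 < a -> 0 < b ->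
  orbit a b k g -> image_is g S -> (forall p, S p -> Vba a b p = h) ->
  invariant (Gba a b) S ->
  exists tau, forall t, Gba a b (g t) = g (t + tau).
Proof.
  intros ha hb Hg Him Hh Hinv.
  destruct (level_bounded a b h ha hb) as [K HK].
  assert (HS : forall t, S (g t)) by (intro t; apply Him; now exists t).
  destruct (proj1 (Him (Gba a b (g 0)))) as [tau Htau]; [ now apply Hinv | ].
  exists tau. apply (orbit_unique a b k K _ _ 0); trivial.
  - now apply orbit_Gba.
  - now apply orbit_shift.
  - intro t. apply HK. rewrite Vba_Gba by assumption. now apply Req_le, Hh.
  - intro t. now apply HK, Req_le, Hh.
  - now rewrite Rplus_0_l.
Qed.

Lemma orbit_circle a b k h g S : 0 < a -> 0 < b ->
  orbit a b k g -> periodic1_inj g -> image_is g S ->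
  (forall p, S p -> Vba a b p = h) -> invariant (Gba a b) S ->
  diffeo_circle S /\ conj_rotation (Gba a b) S.
Proof.
  intros ha hb Hg Hper Him Hh Hinv.
  destruct (level_bounded a b h ha hb) as [K HK].
  split; exists g.
  - repeat split; try apply Hper; try apply Him; try apply (orbit_smooth a b k g Hg).
    (* Injectivity over a period separates the times 0 and [/ 2], so the orbit is not constant. *)
    apply (orbit_regular a b k K g 0 (/ 2)); trivial.
    + intro t. apply HK, Req_le, Hh, Him. now exists t.
    + intro E. apply Hper in E; lra.
  - split; [ exact (orbit_cont a b k g Hg) | ]. do 2 (split; trivial).
    exact (Gba_orbit_shift a b k h g S ha hb Hg Him Hh Hinv).
Qed.

Lemma orbit_line a b k h g S : 0 < a -> 0 < b ->
  orbit a b k g -> (forall s t, g s = g t -> s = t) -> inverse_continuous g ->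
  image_is g S ->
  (forall p, S p -> Vba a b p = h) -> invariant (Gba a b) S ->
  diffeo_line S /\ conj_translation (Gba a b) S.
Proof.
  intros ha hb Hg Hinj Hic Him Hh Hinv.
  destruct (level_bounded a b h ha hb) as [K HK].
  split; exists g.
  - repeat split; trivial; try apply Him; try apply (orbit_smooth a b k g Hg).
    apply (orbit_regular a b k K g 0 1); trivial.
    + intro t. apply HK, Req_le, Hh, Him. now exists t.
    + intro E. apply Hinj in E; lra.
  - split; [ exact (orbit_cont a b k g Hg) | ]. do 3 (split; trivial).
    exact (Gba_orbit_shift a b k h g S ha hb Hg Him Hh Hinv).
Qed.

(** * Time change on the circle *)

Lemma is_derive_pos_lt (f df : R -> R) (s t : R) :
  (forall u, is_derive f u (df u)) -> (forall u, 0 < df u) -> s < t -> f s < f t.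
Proof.
  intros Hd Hpos Hst.
  destruct (MVT_gen f s t df) as [c [_ Hc]].
  - intros; apply Hd.
  - intros u _. apply continuity_pt_filterlim.
    apply (ex_derive_continuous (V := R_NormedModule)). eexists; apply Hd.
  - specialize (Hpos c). nra.
Qed.

(** By the mean value theorem the difference quotient of [Th] at [y] equals [w c] for some [c]
    between [Th y] and [Th (y + h)], and monotonicity of [F] forces [c] towards [Th y]. *)
Lemma inverse_of_increasing (F w : R -> R) :
  (forall x, continuous w x) -> (forall x, 0 < w x) ->
  (forall x, is_derive F x (/ w x)) -> (forall y, exists x, F x = y) ->
  exists Th : R -> R,
    (forall y, F (Th y) = y) /\ (forall x, Th (F x) = x) /\
    (forall y, is_derive Th y (w (Th y))).
Proof.
  intros Hw Hpos HF Hsurj.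
  destruct (functional_choice _ Hsurj) as [Th HTh].
  assert (Hmono : forall x y, x < y -> F x < F y).
  { intros x y. apply (is_derive_pos_lt F (fun x => / w x)); trivial.
    intro; now apply Rinv_0_lt_compat. }
  assert (Hrefl : forall x y, F x < F y -> x < y).
  { intros x y H. apply Rnot_le_lt. intros [H' | ->]; [ apply Hmono in H' | ]; lra. }
  assert (Hinv : forall x, Th (F x) = x).
  { intro x. specialize (HTh (F x)).
    destruct (Rtotal_order (Th (F x)) x) as [H | [H | H]]; trivial;
      apply Hmono in H; lra. }
  exists Th. do 2 (split; trivial).
  intro y. apply is_derive_Reals. intros eps Heps.
  assert (Hc := Hw (Th y)). apply continuity_pt_filterlim in Hc.
  destruct (Hc eps Heps) as [d [Hd Hdw]].
  simpl in Hdw. unfold Rdist in Hdw.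
  assert (L1 : F (Th y) < F (Th y + d)) by (apply Hmono; lra).
  assert (L2 : F (Th y - d) < F (Th y)) by (apply Hmono; lra).
  rewrite HTh in L1, L2.
  assert (Hdel : 0 < Rmin (F (Th y + d) - y) (y - F (Th y - d)))
    by (apply Rmin_glb_lt; lra).
  exists (mkposreal _ Hdel). simpl. intros h Hh0 Hh.
  pose proof (Rmin_l (F (Th y + d) - y) (y - F (Th y - d))).
  pose proof (Rmin_r (F (Th y + d) - y) (y - F (Th y - d))).
  apply Rabs_def2 in Hh.
  assert (Th (y + h) < Th y + d) by (apply Hrefl; rewrite HTh; lra).
  assert (Th y - d < Th (y + h)) by (apply Hrefl; rewrite HTh; lra).
  destruct (MVT_gen F (Th y) (Th (y + h)) (fun x => / w x)) as [c [Hc1 Hc2]].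
  - intros; apply HF.
  - intros u _. apply continuity_pt_filterlim.
    apply (ex_derive_continuous (V := R_NormedModule)). eexists; apply HF.
  - rewrite !HTh in Hc2.
    assert (Q : (Th (y + h) - Th y) / h = w c).
    { specialize (Hpos c). apply (Rmult_eq_reg_l (/ w c * h)).
      - transitivity (/ w c * (Th (y + h) - Th y)); [ field; lra | ].
        rewrite <- Hc2. field. lra.
      - apply Rmult_integral_contrapositive_currified; trivial.
        apply Rinv_neq_0_compat. lra. }
    rewrite Q.
    (* The continuity hypothesis in [Hdw] speaks only of points different from [Th y]. *)
    destruct (Req_dec c (Th y)) as [-> | Hne]; [ rewrite Rminus_diag, Rabs_R0; trivial | ].
    apply Hdw. repeat split; [ now apply not_eq_sym | ].
    unfold Rmin, Rmax in Hc1. destruct (Rle_dec (Th y) (Th (y + h))); apply Rabs_def1; lra.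
Qed.

Lemma is_derive_zero_const (f : R -> R) s t :
  (forall u, is_derive f u 0) -> f s = f t.
Proof.
  intro Hf.
  destruct (MVT_gen f s t (fun _ => 0)) as [c [_ Hc]].
  - intros; apply Hf.
  - intros u _. apply continuity_pt_filterlim.
    apply (ex_derive_continuous (V := R_NormedModule)). eexists; apply Hf.
  - lra.
Qed.

(** Separation of variables: [F] is the integral of [1 / w] from 0, [k = F P] is the time of one
    turn, and [Th t] is the inverse of [F] at [k t]. A step of [P] adds [k] to [F], which gives the
    periodicity of [Th] and, by the intermediate value theorem, the surjectivity of [F]. *)
Lemma time_change (w : R -> R) (P : R) : 0 < P ->
  (forall x, continuous w x) -> (forall x, 0 < w x) ->
  (forall x, w (x + P) = w x) ->
  exists (Th : R -> R) (k : R),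
    (forall t, is_derive Th t (k * w (Th t))) /\
    (forall t, Th (t + 1) = Th t + P) /\
    (forall s t, s < t -> Th s < Th t) /\
    (forall x, exists t, Th t = x) /\ Th 0 = 0.
Proof.
  intros HP Hw Hpos Hper.
  assert (Hiw : forall x, continuous (fun x => / w x) x).
  { intro x. apply continuity_pt_filterlim. apply continuity_pt_inv.
    - apply continuity_pt_filterlim, Hw.
    - specialize (Hpos x); lra. }
  pose (F := (fun x => RInt (fun x => / w x) 0 x) : R -> R).
  assert (HF : forall x, is_derive F x (/ w x)).
  { intro x. apply (is_derive_RInt (V := R_NormedModule) (fun x => / w x) F 0 x); [ | apply Hiw ].
    apply filter_forall. intro y. apply (RInt_correct (V := R_CompleteNormedModule)).
    apply (ex_RInt_continuous (V := R_CompleteNormedModule)). intros; apply Hiw. }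
  assert (F0 : F 0 = 0 :> R) by apply (RInt_point (V := R_CompleteNormedModule)).
  pose (k := F P).
  assert (Hk : 0 < k).
  { rewrite <- F0. apply (is_derive_pos_lt F (fun x => / w x)); trivial.
    intro; now apply Rinv_0_lt_compat. }
  assert (Fper : forall x, F (x + P) = F x + k).
  { intro x.
    enough (E : F (x + P) - F x = F (0 + P) - F 0)
      by (rewrite Rplus_0_l, F0 in E; unfold k; lra).
    apply (is_derive_zero_const (fun x => F (x + P) - F x)). intro u.
    replace 0 with (minus (scal 1 (/ w (u + P))) (/ w u)).
    - apply (is_derive_minus (V := R_NormedModule) (fun x => F (x + P)) F); [ | apply HF ].
      apply (is_derive_comp F (fun x => x + P)); [ apply HF | ].
      auto_derive; trivial; ring.
    - rewrite Hper. change (1 * / w u + - / w u = 0). ring. }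
  assert (FperN : forall n, F (INR n * P) = INR n * k /\ F (- (INR n * P)) = - (INR n * k)).
  { induction n as [ | n [IH1 IH2] ].
    - simpl. rewrite !Rmult_0_l, Ropp_0, F0. split; ring.
    - rewrite S_INR. split.
      + replace ((INR n + 1) * P) with (INR n * P + P) by ring. rewrite Fper, IH1. ring.
      + pose proof (Fper (- ((INR n + 1) * P))) as E.
        replace (- ((INR n + 1) * P) + P) with (- (INR n * P)) in E by ring. lra. }
  assert (Fc : continuity F).
  { intro x. apply continuity_pt_filterlim.
    apply (ex_derive_continuous (V := R_NormedModule)). eexists; apply HF. }
  assert (Fsurj : forall y, exists x, F x = y).
  { intro y. destruct (nfloor_ex (Rabs y / k)) as [n [_ Hn]].
    { apply Rmult_le_pos; [ apply Rabs_pos | left; now apply Rinv_0_lt_compat ]. }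
    rewrite <- S_INR in Hn.
    apply (Rmult_lt_compat_r k) in Hn; trivial.
    replace (Rabs y / k * k) with (Rabs y) in Hn by (field; lra).
    apply Rabs_def2 in Hn. destruct (FperN (S n)) as [E1 E2].
    destruct (IVT_gen F (- (INR (S n) * P)) (INR (S n) * P) y Fc) as [x [_ Hx]].
    - rewrite E1, E2. rewrite Rmin_left, Rmax_right; lra.
    - now exists x. }
  destruct (inverse_of_increasing F w) as [G [G1 [G2 G3]]]; trivial.
  exists (fun t => G (k * t)), k. repeat apply conj.
  - intro t.
    apply (is_derive_comp G (fun t => k * t)); [ apply G3 | ].
    auto_derive; trivial; ring.
  - intro t. rewrite <- (G2 (G (k * t) + P)). rewrite Fper, G1. f_equal. ring.
  - intros s t Hst. apply (is_derive_pos_lt G (fun y => w (G y))); trivial.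
    now apply Rmult_lt_compat_l.
  - intro x. exists (F x / k). replace (k * (F x / k)) with (F x) by (field; lra).
    apply G2.
  - rewrite Rmult_0_r. transitivity (G (F 0)); [ now rewrite F0 | apply G2 ].
Qed.

(** * Level sets as orbits *)

(** When [W ^ 2 = disc a b h y], this is the quadratic formula for [x] in [(a + y ^ 2) x ^ 2 - y x +
    b y ^ 2 - h = 0]. The sign of [W] carries the branch, so [(y, W)] serve as coordinates of the
    plane. *)
Definition lift (a y W : R) : pt := ((W + y) / (2 * (a + y ^ 2)), y).

Definition disc (a b h y : R) : R := y ^ 2 - 4 * (a + y ^ 2) * (b * y ^ 2 - h).
Definition half_disc' (a b h y : R) : R :=
  y - 4 * b * y * (a + y ^ 2) - 4 * y * (b * y ^ 2 - h).

Lemma Vx_lift a b y W : 0 < a -> Vx a b (lift a y W) = W.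
Proof. intro ha. unfold Vx, lift; simpl. field. nra. Qed.

Lemma lift_Vx a b p : 0 < a -> lift a (snd p) (Vx a b p) = p.
Proof.
  intro ha. destruct p as [x y]. unfold Vx, lift; simpl. f_equal. field. nra.
Qed.

Lemma Vx_sqr a b p : (Vx a b p) ^ 2 = disc a b (Vba a b p) (snd p).
Proof. unfold Vx, disc, Vba. ring. Qed.

Lemma Vba_lift a b h y W : 0 < a -> W ^ 2 = disc a b h y -> Vba a b (lift a y W) = h.
Proof.
  intros ha HW. pose proof (Vx_sqr a b (lift a y W)) as E.
  rewrite Vx_lift, HW in E by assumption. unfold disc in E; simpl in E.
  apply (Rmult_eq_reg_l (a + y ^ 2)); nra.
Qed.

Lemma is_derive_lift_fst a (y W : R -> R) t dy dW : 0 < a ->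
  is_derive y t dy -> is_derive W t dW ->
  is_derive (fun s => (W s + y s) / (2 * (a + y s ^ 2))) t
    ((dW + dy) / (2 * (a + y t ^ 2)) - (W t + y t) * y t * dy / (a + y t ^ 2) ^ 2).
Proof.
  intros ha Hy HW. assert (0 < a + y t * y t) by nra.
  auto_derive.
  - repeat split; try (eexists; eassumption). simpl; nra.
  - derive_rewrite. field. simpl; nra.
Qed.

(* [Vx] of a point is a square root of the discriminant of [Vba = h] as a
   quadratic in [x]; along an orbit [y' = k Vx], so [y'' = k^2 disc'(y) / 2]. *)
Lemma orbit_lift a b h k (y W : R -> R) : 0 < a ->
  (forall t, is_derive y t (k * W t)) ->
  (forall t, is_derive W t (k * half_disc' a b h (y t))) ->
  (forall t, W t ^ 2 = disc a b h (y t)) ->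
  orbit a b k (fun t => lift a (y t) (W t)).
Proof.
  intros ha Hy HW HD t. split.
  - pose proof (is_derive_lift_fst a y W t _ _ ha (Hy t) (HW t)) as H.
    derive_by H.
    assert (0 < a + y t * y t) by nra.
    (* The two expressions for [x'] agree only on the curve: their difference is a multiple of
       [W ^ 2 - disc]. *)
    apply Rminus_diag_uniq.
    transitivity (- (k * y t) * (W t ^ 2 - disc a b h (y t)) / (2 * (a + y t ^ 2) ^ 2)).
    + unfold half_disc', disc, Vy, lift; simpl. field. nra.
    + rewrite HD. unfold Rdiv. ring.
  - rewrite Vx_lift by assumption. apply Hy.
Qed.

Lemma unit_circle_angle s c : s ^ 2 + c ^ 2 = 1 -> exists x, sin x = s /\ cos x = c.
Proof.
  intro H. pose proof (pow2_ge_0 s). assert (Hc : -1 <= c <= 1) by nra.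
  assert (E : sin (acos c) = Rabs s).
  { rewrite sin_acos by assumption. rewrite <- sqrt_Rsqr_abs. f_equal. unfold Rsqr. lra. }
  destruct (Rle_dec 0 s) as [Hs | Hs].
  - exists (acos c). rewrite E, cos_acos, Rabs_pos_eq; auto.
  - exists (- acos c). rewrite sin_neg, cos_neg, E, cos_acos, Rabs_left; auto; lra.
Qed.

(** [cos (x - y) = 1] forces [sin ((x - y) / 2) = 0], and half the difference is smaller than [PI]
    in absolute value. *)
Lemma angle_unique x y : 0 <= x < 2 * PI -> 0 <= y < 2 * PI ->
  sin x = sin y -> cos x = cos y -> x = y.
Proof.
  intros Hx Hy Hs Hc.
  assert (Z : sin ((x - y) / 2) = 0).
  { assert (E : cos (x - y) = 1).
    { rewrite cos_minus, Hs, Hc. pose proof (sin2_cos2 y). unfold Rsqr in *. lra. }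
    replace (x - y) with (2 * ((x - y) / 2)) in E by field.
    rewrite cos_2a_sin in E. apply Rsqr_0_uniq. unfold Rsqr. lra. }
  destruct (Rtotal_order x y) as [H | [H | H]]; trivial; exfalso.
  - assert (0 < sin ((y - x) / 2)) by (apply sin_gt_0; lra).
    replace ((x - y) / 2) with (- ((y - x) / 2)) in Z by field.
    rewrite sin_neg in Z. lra.
  - assert (0 < sin ((x - y) / 2)) by (apply sin_gt_0; lra). lra.
Qed.

(* The Hamiltonian time [t] is related to the angle by [d angle = k w dt]. *)
Lemma circle_of_angle a b h (w Y W : R -> R) (S : pt -> Prop) : 0 < a -> 0 < b ->
  (forall x, continuous w x) -> (forall x, 0 < w x) ->
  (forall x, w (x + 2 * PI) = w x) ->
  (forall x, Y (x + 2 * PI) = Y x) -> (forall x, W (x + 2 * PI) = W x) ->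
  (forall x, is_derive Y x (W x / w x)) ->
  (forall x, is_derive W x (half_disc' a b h (Y x) / w x)) ->
  (forall x, W x ^ 2 = disc a b h (Y x)) ->
  (forall u v, Y u = Y v -> W u = W v -> sin u = sin v /\ cos u = cos v) ->
  (forall p, S p <-> exists x, Y x = snd p /\ W x = Vx a b p) ->
  invariant (Gba a b) S ->
  diffeo_circle S /\ conj_rotation (Gba a b) S.
Proof.
  intros ha hb Hw Hpos Hwp HYp HWp HY HW HD Hinj HS Hinv.
  destruct (time_change w (2 * PI)) as [Th [k [T1 [T2 [T3 [T4 T5]]]]]]; trivial.
  { pose proof PI_RGT_0. lra. }
  pose (g := fun t => lift a (Y (Th t)) (W (Th t))).
  apply (orbit_circle a b k h g S); trivial.
  - apply (orbit_lift a b h k (fun t => Y (Th t)) (fun t => W (Th t))); trivial.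
    + intro t. replace (k * W (Th t)) with (k * w (Th t) * (W (Th t) / w (Th t)))
        by (field; specialize (Hpos (Th t)); lra).
      exact (is_derive_comp Y Th t _ _ (HY _) (T1 t)).
    + intro t. replace (k * half_disc' a b h (Y (Th t)))
        with (k * w (Th t) * (half_disc' a b h (Y (Th t)) / w (Th t)))
        by (field; specialize (Hpos (Th t)); lra).
      exact (is_derive_comp W Th t _ _ (HW _) (T1 t)).
  - split.
    + intro t. unfold g. now rewrite T2, HYp, HWp.
    + intros s t Hs Ht E.
      assert (I : forall u, 0 <= u < 1 -> 0 <= Th u < 2 * PI).
      { intros u Hu. rewrite <- T5.
        replace (2 * PI) with (Th 1) by (rewrite <- (Rplus_0_l 1), T2, T5; ring).
        split; [ | now apply T3 ].
        destruct Hu as [[Hu | <-] _]; [ left; now apply T3 | apply Rle_refl ]. }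
      assert (E1 : Y (Th s) = Y (Th t)) by exact (f_equal snd E).
      assert (E2 : W (Th s) = W (Th t)).
      { apply (f_equal (Vx a b)) in E. unfold g in E. now rewrite !Vx_lift in E. }
      destruct (Hinj _ _ E1 E2) as [E3 E4].
      assert (E5 := angle_unique _ _ (I s Hs) (I t Ht) E3 E4).
      destruct (Rtotal_order s t) as [H | [H | H]]; trivial; apply T3 in H; lra.
  - intro p. rewrite HS. split.
    + intros [x [E1 E2]]. destruct (T4 x) as [t <-]. exists t. unfold g.
      rewrite E1, E2. now apply lift_Vx.
    + intros [t <-]. exists (Th t). unfold g. rewrite Vx_lift by assumption. now split.
  - intros p Hp. apply HS in Hp. destruct Hp as [x [E1 E2]].
    rewrite <- (lift_Vx a b p) by assumption. rewrite <- E1, <- E2.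
    now apply Vba_lift.
Qed.

Lemma level_invariant a b h : 0 < a -> 0 < b -> invariant (Gba a b) (level a b h).
Proof. intros ha hb p Hp. unfold level. now rewrite Vba_Gba. Qed.

Lemma positive_level_circle a b h : 0 < a -> 0 < b -> 0 < h ->
  diffeo_circle (level a b h) /\ conj_rotation (Gba a b) (level a b h).
Proof.
  intros ha hb hh.
  (* [disc] equals [4 b (q + 2 m y ^ 2 - y ^ 4)], with roots [m + r] and [m - r] in [y ^ 2], where
     [r ^ 2 = m ^ 2 + q]. Since [q > 0] their signs are opposite: [A ^ 2 = m + r] is the squared
     amplitude of [y], and [c = r - m] is positive. *)
  pose (m := (1 + 4 * h - 4 * a * b) / (8 * b)).
  pose (q := a * h / b).
  assert (Hm : 8 * b * m = 1 + 4 * h - 4 * a * b) by (unfold m; field; lra).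
  assert (Hq : b * q = a * h) by (unfold q; field; lra).
  assert (Hq0 : 0 < q) by (apply Rdiv_lt_0_compat; nra).
  clearbody m q.
  assert (Hr : 0 <= m ^ 2 + q) by nra.
  pose proof (sqrt_pos (m ^ 2 + q)) as Hr0. pose proof (sqrt_sqrt _ Hr) as Hr2.
  set (r := sqrt (m ^ 2 + q)) in *. clearbody r.
  assert (Hc : 0 < r - m) by nra. assert (HY : 0 < r + m) by nra.
  pose (A := sqrt (r + m)). pose (c := r - m).
  assert (HA : 0 < A) by now apply sqrt_lt_R0.
  assert (HA2 : A * A = r + m) by (apply sqrt_sqrt; lra).
  assert (HAc : b * (A * A * c) = a * h) by (rewrite HA2, <- Hq; unfold c; nra).
  assert (HAm : 4 * b * (A * A - c) = 1 + 4 * h - 4 * a * b)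
    by (rewrite HA2, <- Hm; unfold c; ring).
  assert (Hc0 : 0 < c) by exact Hc.
  clearbody A c.
  pose proof (sqrt_lt_R0 _ hb) as Hsb.
  assert (Hsb2 : sqrt b * sqrt b = b) by (apply sqrt_sqrt; lra).
  set (sb := sqrt b) in *. clearbody sb.
  pose (R0 := fun x => A ^ 2 * sin x ^ 2 + c).
  assert (HR0 : forall x, 0 < R0 x)
    by (intro x; unfold R0; pose proof (pow2_ge_0 (A * sin x)); nra).
  (* For [y = A sin x] the discriminant is [(A cos x) ^ 2 w ^ 2]. So [Vx = A cos x w], and [w] is
     the speed of the angle in Hamiltonian time. *)
  pose (w := fun x => 2 * sb * sqrt (R0 x)).
  assert (Hw : forall x, 0 < w x).
  { intro x. unfold w. pose proof (sqrt_lt_R0 _ (HR0 x)). nra. }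
  assert (Hw2 : forall x, w x ^ 2 = 4 * b * R0 x).
  { intro x. unfold w. rewrite <- Hsb2. pose proof (sqrt_sqrt (R0 x) (Rlt_le _ _ (HR0 x))).
    transitivity (4 * (sb * sb) * (sqrt (R0 x) * sqrt (R0 x))); [ ring | now rewrite H ]. }
  assert (Hper : forall x, sin (x + 2 * PI) = sin x /\ cos (x + 2 * PI) = cos x).
  { intro x. rewrite sin_plus, cos_plus, sin_2PI, cos_2PI. split; ring. }
  assert (Hwd : forall x, is_derive w x (4 * b * A ^ 2 * sin x * cos x / w x)).
  { intro x. pose proof (HR0 x) as HR. unfold w, R0 in *. auto_derive; [ simpl in *; tauto | ].
    rewrite <- Hsb2. pose proof (sqrt_lt_R0 _ HR).
    simpl in *. field. split; lra. }
  assert (Hsc : forall x, cos x ^ 2 = 1 - sin x ^ 2).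
  { intro x. pose proof (sin2_cos2 x). unfold Rsqr in *. lra. }
  apply (circle_of_angle a b h w (fun x => A * sin x) (fun x => A * cos x * w x)); trivial.
  - intro x. apply (ex_derive_continuous (V := R_NormedModule)). eexists; apply Hwd.
  - intro x. unfold w, R0. now rewrite (proj1 (Hper x)).
  - intro x. now rewrite (proj1 (Hper x)).
  - intro x. unfold w, R0. now rewrite (proj1 (Hper x)), (proj2 (Hper x)).
  - intro x. auto_derive; trivial. field. specialize (Hw x); lra.
  - intro x. pose proof (Hwd x) as Hd. pose proof (Hw x) as Hwx. pose proof (Hw2 x) as E.
    auto_derive; [ repeat split; eexists; eassumption | ]. derive_rewrite.
    apply (Rmult_eq_reg_r (w x)); [ | lra ].
    transitivity (A * sin x * (- w x ^ 2 + 4 * b * A ^ 2 * cos x ^ 2)); [ field; lra | ].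
    rewrite E, Hsc. unfold R0, half_disc'.
    transitivity (A * sin x * (4 * b * (A * A - c) - 8 * b * A ^ 2 * sin x ^ 2)); [ ring | ].
    rewrite HAm. field. lra.
  - intro x. transitivity (A ^ 2 * cos x ^ 2 * w x ^ 2); [ ring | ].
    rewrite Hw2, Hsc. unfold R0, disc.
    transitivity (4 * b * (A * A - c) * (A * sin x) ^ 2 - 4 * b * (A * sin x) ^ 4 + 4 * (b * (A * A * c)));
      [ ring | ].
    rewrite HAm, HAc. ring.
  - intros u v E1 E2.
    assert (E3 : sin u = sin v) by (apply (Rmult_eq_reg_l A); lra).
    split; trivial.
    assert (E4 : w u = w v) by (unfold w, R0; now rewrite E3).
    rewrite E4 in E2. apply (Rmult_eq_reg_l (A * w v)).
    + lra.
    + specialize (Hw v). apply Rgt_not_eq, Rmult_lt_0_compat; lra.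
  - intro p. split.
    + intro Hp. unfold level in Hp. pose proof (Vx_sqr a b p) as E. rewrite Hp in E.
      set (y := snd p) in *. set (V := Vx a b p) in *.
      assert (HRy : 0 < y ^ 2 + c) by (pose proof (pow2_ge_0 y); lra).
      (* [v] is the value that [w] must take at the angle sought, written in terms of [y] because
         the angle is not yet known. *)
      pose (v := 2 * sb * sqrt (y ^ 2 + c)).
      assert (Hv : 0 < v).
      { unfold v. pose proof (sqrt_lt_R0 _ HRy). nra. }
      assert (Hv2 : v ^ 2 = 4 * b * (y ^ 2 + c)).
      { unfold v. pose proof (sqrt_sqrt _ (Rlt_le _ _ HRy)).
        transitivity (4 * (sb * sb) * (sqrt (y ^ 2 + c) * sqrt (y ^ 2 + c)));
          [ ring | now rewrite H, Hsb2 ]. }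
      destruct (unit_circle_angle (y / A) (V / (A * v))) as [x [Hs Hx]].
      { apply (Rmult_eq_reg_r (A ^ 2 * v ^ 2)).
        - transitivity (y ^ 2 * v ^ 2 + V ^ 2); [ field; lra | ].
          rewrite E, Hv2. unfold disc.
          transitivity (y ^ 2 * (4 * b * (y ^ 2 + c)) +
            (y ^ 2 * (1 + 4 * h - 4 * a * b) - 4 * b * y ^ 4 + 4 * (a * h)));
            [ ring | ].
          rewrite <- HAm, <- HAc. ring.
        - apply Rgt_not_eq. apply Rmult_lt_0_compat; apply pow_lt; assumption. }
      exists x. rewrite Hs, Hx.
      assert (Ew : w x = v).
      { unfold w, v, R0. rewrite Hs. do 2 f_equal. field. lra. }
      rewrite Ew. split; field; lra.
    + intros [x [E1 E2]]. unfold level. rewrite <- (lift_Vx a b p) by assumption.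
      apply Vba_lift; trivial. rewrite <- E1, <- E2.
      transitivity (A ^ 2 * cos x ^ 2 * w x ^ 2); [ ring | ].
      rewrite Hw2, Hsc. unfold R0, disc.
      transitivity (4 * b * (A * A - c) * (A * sin x) ^ 2 - 4 * b * (A * sin x) ^ 4 + 4 * (b * (A * A * c)));
        [ ring | ].
      rewrite HAm, HAc. ring.
  - now apply level_invariant.
Qed.

(** * Components of the nonpositive levels, and the circles of the negative ones *)

(** [Vba <= 0] gives [x y >= a x ^ 2 + b y ^ 2 + x ^ 2 y ^ 2], which is positive once [y] is
    nonzero; the coordinates then share their sign. *)
Lemma half_plane_swap a b p s : 0 < a -> 0 < b -> Vba a b p <= 0 ->
  0 < s * snd p -> 0 < s * fst p.
Proof.
  intros ha hb Hp Hs. destruct p as [x y]. unfold Vba in Hp. simpl fst in *. simpl snd in *.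
  assert (Hy : 0 < y ^ 2) by (apply pow2_gt_0; intros ->; lra).
  assert (0 < x * y).
  { pose proof (pow2_ge_0 x). pose proof (pow2_ge_0 (x * y)). nra. }
  apply (Rmult_lt_reg_r (s * y)); trivial.
  assert (0 < s ^ 2) by (apply pow2_gt_0; intros ->; lra). nra.
Qed.

(** A level [h <= 0] meets the line [y = 0] at most at the origin, so the sign of [y] separates its
    two branches. With the sign [s = 1] or [s = -1] as a parameter, both are treated at once. *)
Definition half_level (a b h s : R) : pt -> Prop :=
  fun p => Vba a b p = h /\ 0 < s * snd p.

(** The first coordinate after [Gbeta] is the old [y]; [half_plane_swap], applied to the image with
    its coordinates exchanged, passes the sign on to the new second coordinate. *)
Lemma half_level_invariant a b h s : 0 < a -> 0 < b -> h <= 0 ->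
  invariant (Gba a b) (half_level a b h s).
Proof.
  intros ha hb hh.
  assert (I : forall a b p, 0 < a -> 0 < b -> half_level a b h s p ->
    half_level b a h s (Gbeta a p)).
  { intros a' b' p ha' hb' [H1 H2].
    assert (E : Vba b' a' (Gbeta a' p) = h) by now rewrite Vba_Gbeta.
    split; trivial.
    apply (half_plane_swap a' b' (snd (Gbeta a' p), fst (Gbeta a' p)) s); trivial.
    replace (Vba a' b' _) with (Vba b' a' (Gbeta a' p)) by (unfold Vba; simpl; ring).
    lra. }
  intros p Hp. unfold Gba. auto.
Qed.

(** For [a b < 1/4] the two squares vanish together exactly at the points [Pfix_plus] and
    [Pfix_minus]. This explains the value of [hmin] and yields the two equations by which these
    points are handled below. *)
Lemma Vba_sum_squares a b p : 0 < a -> 0 < b ->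
  Vba a b p = hmin a b + (sqrt a * fst p - sqrt b * snd p) ^ 2
              + (fst p * snd p - (/ 2 - sqrt (a * b))) ^ 2.
Proof.
  intros ha hb. unfold Vba, hmin.
  assert (Ha := sqrt_sqrt a (Rlt_le _ _ ha)). assert (Hb := sqrt_sqrt b (Rlt_le _ _ hb)).
  rewrite sqrt_mult by lra. set (u := sqrt a) in *. set (v := sqrt b) in *.
  rewrite <- Ha, <- Hb. field.
Qed.

Lemma hmin_le a b p : 0 < a -> 0 < b -> hmin a b <= Vba a b p.
Proof.
  intros ha hb. rewrite (Vba_sum_squares a b p ha hb).
  pose proof (pow2_ge_0 (sqrt a * fst p - sqrt b * snd p)).
  pose proof (pow2_ge_0 (fst p * snd p - (/ 2 - sqrt (a * b)))). lra.
Qed.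

Lemma sqrt_ab_lt_half a b : 0 < a -> 0 < b -> a * b < / 4 ->
  0 < sqrt (a * b) < / 2 /\ sqrt (a * b) * sqrt (a * b) = a * b.
Proof.
  intros ha hb hab. assert (0 < a * b) by nra.
  pose proof (sqrt_lt_R0 _ H). pose proof (sqrt_sqrt (a * b) (Rlt_le _ _ H)).
  repeat split; trivial. nra.
Qed.

Lemma negative_half_level_circle a b h s : 0 < a -> 0 < b -> a * b < / 4 ->
  hmin a b < h -> h < 0 -> s * s = 1 ->
  diffeo_circle (half_level a b h s) /\ conj_rotation (Gba a b) (half_level a b h s).
Proof.
  intros ha hb hab hh hh0 hs.
  (* Here [q > 0] and [disc = 4 b (r ^ 2 - (y ^ 2 - m) ^ 2)] with [r ^ 2 = m ^ 2 - q]. The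
     parametrization of [y ^ 2] requires [0 < r < m]. *)
  pose (m := (1 + 4 * h - 4 * a * b) / (8 * b)).
  pose (q := - a * h / b).
  assert (Hm : 8 * b * m = 1 + 4 * h - 4 * a * b) by (unfold m; field; lra).
  assert (Hq : b * q = - (a * h)) by (unfold q; field; lra).
  assert (Hq0 : 0 < q) by (apply Rdiv_lt_0_compat; nra).
  clearbody m q.
  destruct (sqrt_ab_lt_half a b ha hb hab) as [[K1 K2] K3].
  unfold hmin in hh. set (k := sqrt (a * b)) in *. clearbody k.
  (* [d] is the height above the minimum. In terms of [d] and [k = sqrt (a b)], positive multiples
     of [m] and of [m ^ 2 - q] become sums of positive terms. *)
  pose (d := h - (- / 4 - a * b + k)). assert (Hd : 0 < d) by (unfold d; lra).
  assert (Hh : h = d - (/ 2 - k) ^ 2) by (unfold d; rewrite <- K3; field).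
  assert (Hm' : 8 * b * m = 8 * k * (/ 2 - k) + 4 * d)
    by (rewrite Hm, Hh; replace (4 * a * b) with (4 * (a * b)) by ring; rewrite <- K3; field).
  assert (Hm0 : 0 < m).
  { apply (Rmult_lt_reg_l (8 * b)); [ lra | ]. rewrite Hm', Rmult_0_r. nra. }
  assert (Hr : 0 < m ^ 2 - q).
  { apply (Rmult_lt_reg_l (64 * b ^ 2)); [ nra | ].
    replace (64 * b ^ 2 * (m ^ 2 - q)) with ((8 * b * m) ^ 2 - 64 * b * (b * q)) by ring.
    rewrite Hm', Hq, Rmult_0_r.
    replace (64 * b * - (a * h)) with (64 * (a * b) * - h) by ring.
    rewrite <- K3, Hh.
    replace (_ - _) with (64 * k * (/ 2 - k) * d + 16 * d ^ 2 + 64 * k ^ 2 * d) by ring.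
    assert (0 < k * (/ 2 - k)) by nra. nra. }
  pose proof (sqrt_lt_R0 _ Hr) as Hr0. pose proof (sqrt_sqrt _ (Rlt_le _ _ Hr)) as Hr2.
  set (r := sqrt (m ^ 2 - q)) in *. clearbody r.
  (* [q > 0], that is [h < 0], keeps [y ^ 2] away from zero, hence the curve in one half plane. *)
  assert (Hrm : r < m) by nra.
  pose proof (sqrt_lt_R0 _ hb) as Hsb.
  assert (Hsb2 : sqrt b * sqrt b = b) by (apply sqrt_sqrt; lra).
  set (sb := sqrt b) in *. clearbody sb.
  assert (HR : forall x, 0 < m + r * cos x).
  { intro x. pose proof (COS_bound x). nra. }
  pose (R1 := fun x => sqrt (m + r * cos x)).
  assert (HR1 : forall x, 0 < R1 x) by (intro; apply sqrt_lt_R0, HR).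
  assert (HR2 : forall x, R1 x ^ 2 = m + r * cos x).
  { intro x. rewrite <- (sqrt_sqrt (m + r * cos x)) by (apply Rlt_le, HR).
    unfold R1. ring. }
  assert (Hper : forall x, sin (x + 2 * PI) = sin x /\ cos (x + 2 * PI) = cos x).
  { intro x. rewrite sin_plus, cos_plus, sin_2PI, cos_2PI. split; ring. }
  assert (HRd : forall x, is_derive R1 x (- (r * sin x) / (2 * R1 x))).
  { intro x. pose proof (HR1 x). unfold R1 in *. auto_derive; [ apply HR | ].
    field. lra. }
  assert (Hsc : forall x, sin x ^ 2 = 1 - cos x ^ 2).
  { intro x. pose proof (sin2_cos2 x). unfold Rsqr in *. lra. }
  assert (hs2 : s ^ 2 = 1) by (simpl; lra).
  assert (HD : forall y, disc a b h y = 4 * b * (r * r - (y ^ 2 - m) ^ 2)).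
  { intro y. unfold disc. rewrite Hr2.
    transitivity (y ^ 2 * (1 + 4 * h - 4 * a * b) - 4 * b * y ^ 4 + 4 * (a * h)); [ ring | ].
    replace (a * h) with (- (b * q)) by lra. rewrite <- Hm. ring. }
  assert (HDs : forall x, (- (2 * s * sb * r * sin x)) ^ 2 = disc a b h (s * R1 x)).
  { intro x. rewrite HD, Rpow_mult_distr, hs2, HR2.
    transitivity (4 * s ^ 2 * (sb * sb) * (r * r) * sin x ^ 2); [ ring | ].
    rewrite hs2, Hsb2, Hsc. ring. }
  (* The factor [4 * sb * R1] is the ratio of [Vx] to the derivative of [s * R1] in the angle; the
     minus sign in [Vx] comes from differentiating the cosine. *)
  apply (circle_of_angle a b h (fun x => 4 * sb * R1 x) (fun x => s * R1 x)
           (fun x => - (2 * s * sb * r * sin x))); trivial.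
  - intro x. apply (ex_derive_continuous (V := R_NormedModule)).
    auto_derive. eexists; apply HRd.
  - intro x. specialize (HR1 x). nra.
  - intro x. unfold R1. now rewrite (proj2 (Hper x)).
  - intro x. unfold R1. now rewrite (proj2 (Hper x)).
  - intro x. now rewrite (proj1 (Hper x)).
  - intro x. pose proof (HRd x) as Hdx. auto_derive; [ eexists; eassumption | ].
    derive_rewrite. field. specialize (HR1 x). lra.
  - intro x. auto_derive; trivial.
    transitivity (- (8 * b * (s * R1 x) * ((s * R1 x) ^ 2 - m)) / (4 * sb * R1 x)).
    + rewrite Rpow_mult_distr, hs2, HR2, <- Hsb2. field. specialize (HR1 x). lra.
    + f_equal. unfold half_disc'.
      transitivity (- (8 * b * (s * R1 x) ^ 3) + (8 * b * m) * (s * R1 x)); [ ring | ].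
      rewrite Hm. ring.
  - intros u v E1 E2. assert (E3 : sin u = sin v).
    { apply (Rmult_eq_reg_l (2 * s * sb * r)); [ lra | ].
      intro Z. assert (s * (2 * sb * r) = 0) by lra. apply Rmult_integral in H.
      destruct H; [ subst s; lra | ]. assert (0 < 2 * sb * r) by (apply Rmult_lt_0_compat; lra). lra. }
    split; trivial.
    assert (E4 : (s * R1 u) ^ 2 = (s * R1 v) ^ 2) by now rewrite E1.
    rewrite !Rpow_mult_distr, hs2, !HR2 in E4.
    apply (Rmult_eq_reg_l r); lra.
  - intro p. split.
    + intros [Hp Hy]. pose proof (Vx_sqr a b p) as E. rewrite Hp, HD in E.
      set (y := snd p) in *. set (V := Vx a b p) in *.
      destruct (unit_circle_angle (- V / (2 * s * sb * r)) ((y ^ 2 - m) / r)) as [x [Hsx Hx]].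
      { assert (s <> 0) by (intros ->; lra).
        transitivity (V ^ 2 / (4 * s ^ 2 * (sb * sb) * (r * r)) + (y ^ 2 - m) ^ 2 / (r * r));
          [ field; lra | ].
        rewrite E, hs2, Hsb2. field. lra. }
      exists x.
      assert (Ey : R1 x = s * y).
      { unfold R1. rewrite Hx.
        replace (m + r * ((y ^ 2 - m) / r)) with ((s * y) * (s * y)).
        - apply sqrt_square. lra.
        - transitivity (s ^ 2 * y ^ 2); [ ring | ]. rewrite hs2. field. lra. }
      rewrite Ey, Hsx. split.
      * transitivity (s * s * y); [ ring | rewrite hs; ring ].
      * field. repeat split; try lra. intros ->; lra.
    + intros [x [E1 E2]]. split.
      * rewrite <- (lift_Vx a b p) by assumption. apply Vba_lift; trivial.
        rewrite <- E1, <- E2. apply HDs.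
      * rewrite <- E1. specialize (HR1 x). replace (s * (s * R1 x)) with (s * s * R1 x) by ring.
        rewrite hs. lra.
  - apply half_level_invariant; trivial; lra.
Qed.

(** * Metric estimates and the homoclinic orbits of the zero level *)

Lemma coord_le_dist2 p q :
  Rabs (fst p - fst q) <= dist2 p q /\ Rabs (snd p - snd q) <= dist2 p q.
Proof.
  unfold dist2. set (u := fst p - fst q). set (v := snd p - snd q).
  pose proof (pow2_ge_0 u). pose proof (pow2_ge_0 v).
  split; rewrite <- sqrt_Rsqr_abs; apply sqrt_le_1_alt; unfold Rsqr; lra.
Qed.

Lemma dist2_le_coords p q :
  dist2 p q <= Rabs (fst p - fst q) + Rabs (snd p - snd q).
Proof.
  unfold dist2. set (u := fst p - fst q). set (v := snd p - snd q).
  pose proof (Rabs_pos u). pose proof (Rabs_pos v).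
  rewrite <- (sqrt_Rsqr (Rabs u + Rabs v)) by lra.
  apply sqrt_le_1_alt. unfold Rsqr. rewrite <- (pow2_abs u), <- (pow2_abs v). nra.
Qed.

Lemma continuous_dist2 (f : pt -> R) (p : pt) eps : 0 < eps ->
  continuous (f : R2top -> R_UniformSpace) p ->
  exists d, 0 < d /\ forall q, dist2 q p < d -> Rabs (f q - f p) < eps.
Proof.
  intros Heps Hf.
  destruct (proj1 (filterlim_locally _ _) Hf (mkposreal eps Heps)) as [d Hd].
  exists d. split; [ apply cond_pos | ]. intros q Hq.
  destruct (coord_le_dist2 q p).
  apply (Hd q). split.
  - change (Rabs (fst q - fst p) < d). lra.
  - change (Rabs (snd q - snd p) < d). lra.
Qed.

(** A continuous function of the point that increases along [g] recovers time: nearby points have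
    nearby values, hence by monotonicity nearby times. *)
Lemma inverse_continuous_of_increasing (g : R -> pt) (f : pt -> R) :
  (forall t, continuous (f : R2top -> R_UniformSpace) (g t)) ->
  (forall s t, s < t -> f (g s) < f (g t)) ->
  (forall s t, g s = g t -> s = t) /\ inverse_continuous g.
Proof.
  intros Hc Hm. split.
  - intros s t E. destruct (Rtotal_order s t) as [H | [H | H]]; trivial;
      apply Hm in H; rewrite E in H; lra.
  - intros t eps Heps.
    assert (L1 : f (g t) < f (g (t + eps))) by (apply Hm; lra).
    assert (L2 : f (g (t - eps)) < f (g t)) by (apply Hm; lra).
    destruct (continuous_dist2 f (g t)
      (Rmin (f (g (t + eps)) - f (g t)) (f (g t) - f (g (t - eps)))))
      as [d [Hd HdE]].
    { apply Rmin_glb_lt; lra. }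
    { apply Hc. }
    exists d. split; trivial. intros s Hs. apply HdE in Hs.
    pose proof (Rmin_l (f (g (t + eps)) - f (g t)) (f (g t) - f (g (t - eps)))).
    pose proof (Rmin_r (f (g (t + eps)) - f (g t)) (f (g t) - f (g (t - eps)))).
    apply Rabs_def2 in Hs.
    assert (Hr : forall u v, f (g u) < f (g v) -> u < v).
    { intros u v Huv. apply Rnot_le_lt. intros [H' | ->]; [ apply Hm in H' | ]; lra. }
    apply Rabs_def1.
    + enough (s < t + eps) by lra. apply Hr. lra.
    + enough (t - eps < s) by lra. apply Hr. lra.
Qed.

(** On a homoclinic orbit this quotient is [- y' / y = L tanh (L t)], the increasing function that
    recovers time. *)
Lemma continuous_slope a b (p : pt) : snd p <> 0 ->
  continuous ((fun q => - Vx a b q / snd q)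
    : R2top -> R_UniformSpace) p.
Proof.
  intro Hp. unfold Vx, Rdiv.
  assert (Hf : continuous (fst : R2top -> R_UniformSpace) p)
    by (destruct p; apply continuous_fst).
  assert (Hs : continuous (snd : R2top -> R_UniformSpace) p)
    by (destruct p; apply continuous_snd).
  apply (continuous_mult (K := R_AbsRing)).
  - apply (continuous_opp (V := R_NormedModule)).
    apply (continuous_minus (V := R_NormedModule)); [ | exact Hs ].
    apply (continuous_mult (K := R_AbsRing)); [ | exact Hf ].
    apply (continuous_mult (K := R_AbsRing)); [ apply continuous_const | ].
    apply (continuous_plus (V := R_NormedModule)); [ apply continuous_const | ].
    simpl. apply (continuous_mult (K := R_AbsRing)); [ exact Hs | ].
    apply (continuous_mult (K := R_AbsRing)); [ exact Hs | apply continuous_const ].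
  - apply (continuous_comp (snd : R2top -> R_UniformSpace) Rinv); [ exact Hs | ].
    now apply continuous_Rinv.
Qed.

Lemma cosh_sinh_sqr u : cosh u ^ 2 = 1 + sinh u ^ 2.
Proof.
  unfold cosh, sinh.
  assert (E : exp u * exp (- u) = 1)
    by (rewrite <- exp_plus, Rplus_opp_r; apply exp_0).
  transitivity (exp u * exp (- u) + ((exp u - exp (- u)) / 2) ^ 2); [ field | now rewrite E ].
Qed.

Lemma cosh_ge u : (1 + Rabs u) / 2 <= cosh u.
Proof.
  unfold cosh. pose proof (exp_pos u). pose proof (exp_pos (- u)).
  pose proof (exp_ineq1_le u). pose proof (exp_ineq1_le (- u)).
  unfold Rabs. destruct (Rcase_abs u); lra.
Qed.

Definition tends_to_origin (g : R -> pt) : Prop :=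
  forall eps, 0 < eps -> exists T, forall t, T < Rabs t -> dist2 (g t) origin < eps.

(** At [h = 0] the discriminant is [L ^ 2 y ^ 2 - 4 b y ^ 4] with [L ^ 2 = 1 - 4 a b], and a
    hyperbolic secant solves [y' ^ 2 = disc] in Hamiltonian time itself, so [k = 1] and no time
    change occurs. [L] is the rate of the linearized field at the origin; [A] is the turning value
    of [|y|]. *)
Lemma homoclinic_orbit a b s : 0 < a -> 0 < b -> a * b < / 4 -> s * s = 1 ->
  exists g, orbit a b 1 g /\ (forall u v, g u = g v -> u = v) /\ inverse_continuous g /\
    image_is g (half_level a b 0 s) /\ tends_to_origin g.
Proof.
  intros ha hb hab hs.
  assert (hs0 : s <> 0) by (intros ->; lra).
  assert (hs2 : s ^ 2 = 1) by (simpl; lra).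
  pose proof (sqrt_lt_R0 _ hb) as Hsb.
  assert (Hsb2 : sqrt b * sqrt b = b) by (apply sqrt_sqrt; lra).
  set (sb := sqrt b) in *. clearbody sb.
  assert (HQ : 0 < 1 - 4 * (a * b)) by lra.
  pose proof (sqrt_lt_R0 _ HQ) as HL.
  pose proof (sqrt_sqrt _ (Rlt_le _ _ HQ)) as HL2.
  set (L := sqrt (1 - 4 * (a * b))) in *. clearbody L.
  pose (A := L / (2 * sb)).
  assert (HA : 0 < A) by (apply Rdiv_lt_0_compat; lra).
  assert (HA2 : 4 * b * A ^ 2 = L ^ 2) by (unfold A; rewrite <- Hsb2; field; lra).
  clearbody A.
  assert (Hch : forall u, 0 < cosh u).
  { intro u. pose proof (cosh_ge u). pose proof (Rabs_pos u). lra. }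
  pose (y := fun t => s * A / cosh (L * t)).
  pose (W := fun t => - (L * (s * A) * sinh (L * t) / cosh (L * t) ^ 2)).
  pose (g := fun t => lift a (y t) (W t)).
  assert (HD : forall z, disc a b 0 z = L ^ 2 * z ^ 2 - 4 * b * z ^ 4).
  { intro z. unfold disc. replace (L ^ 2) with (L * L) by ring. rewrite HL2. ring. }
  assert (HWD : forall t, W t ^ 2 = disc a b 0 (y t)).
  { intro t. rewrite HD. unfold W, y. specialize (Hch (L * t)).
    pose proof (cosh_sinh_sqr (L * t)) as E.
    transitivity (L ^ 2 * s ^ 2 * A ^ 2 * sinh (L * t) ^ 2 / cosh (L * t) ^ 4); [ field; lra | ].
    transitivity (L ^ 2 * s ^ 2 * A ^ 2 / cosh (L * t) ^ 2
      - s ^ 2 * s ^ 2 * A ^ 2 * (4 * b * A ^ 2) / cosh (L * t) ^ 4);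
      [ | field; lra ].
    rewrite HA2, hs2. replace (sinh (L * t) ^ 2) with (cosh (L * t) ^ 2 - 1) by lra.
    field. lra. }
  assert (Hmono : forall u v, u < v -> - W u / y u < - W v / y v).
  { intros u v Huv.
    assert (E : forall t, - W t / y t = L * sinh (L * t) / cosh (L * t)).
    { intro t. unfold W, y. specialize (Hch (L * t)). field. repeat split; lra. }
    rewrite !E.
    apply (is_derive_pos_lt (fun t => L * sinh (L * t) / cosh (L * t))
      (fun t => L ^ 2 / cosh (L * t) ^ 2)); trivial.
    - intro t. pose proof (Hch (L * t)). auto_derive; [ lra | ].
      pose proof (cosh_sinh_sqr (L * t)) as E1.
      replace (L ^ 2) with (L ^ 2 * (cosh (L * t) ^ 2 - sinh (L * t) ^ 2)) by (rewrite E1; ring).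
      field. lra.
    - intro t. specialize (Hch (L * t)). apply Rdiv_lt_0_compat; apply pow_lt; lra. }
  assert (Hy0 : forall t, 0 < s * y t).
  { intro t. unfold y. replace (s * (s * A / cosh (L * t))) with (s * s * A / cosh (L * t))
      by (unfold Rdiv; ring).
    rewrite hs, Rmult_1_l. now apply Rdiv_lt_0_compat. }
  destruct (inverse_continuous_of_increasing g (fun q => - Vx a b q / snd q)) as [Hinj Hinv].
  - intro t. apply continuous_slope. simpl. specialize (Hy0 t). intro E. rewrite E in Hy0. lra.
  - intros u v Huv. unfold g. rewrite !Vx_lift by assumption. simpl. now apply Hmono.
  - exists g. repeat apply conj; trivial.
    + apply (orbit_lift a b 0 1 y W); trivial.
      * intro t. pose proof (Hch (L * t)). unfold y, W. auto_derive; [ lra | ]. field. lra.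
      * intro t. pose proof (Hch (L * t)). unfold W. auto_derive; [ simpl; nra | ].
        pose proof (cosh_sinh_sqr (L * t)) as E1.
        transitivity (L ^ 2 * (s * A) * (2 * sinh (L * t) ^ 2 - cosh (L * t) ^ 2) / cosh (L * t) ^ 3);
          [ field; lra | ].
        transitivity ((1 - 4 * (a * b)) * y t - 8 * b * y t ^ 3); [ | unfold half_disc'; ring ].
        rewrite <- HL2. unfold y.
        transitivity (L ^ 2 * (s * A) / cosh (L * t)
          - 2 * (4 * b * A ^ 2) * s ^ 2 * (s * A) / cosh (L * t) ^ 3);
          [ | field; lra ].
        rewrite HA2, hs2. replace (sinh (L * t) ^ 2) with (cosh (L * t) ^ 2 - 1) by lra. field. lra.
    + intro p. split.
      * intros [Hp Hsy]. pose proof (Vx_sqr a b p) as E. rewrite Hp, HD in E.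
        rewrite <- (lift_Vx a b p) by assumption.
        set (z := snd p) in *. set (V := Vx a b p) in *.
        assert (Hz : z <> 0) by (intro Z; rewrite Z in Hsy; lra).
        (* Solves [cosh = s A / z] and the formula for [W] for the hyperbolic sine. *)
        pose (sh := - V * (s * A) / (L * z ^ 2)).
        exists (arcsinh sh / L). unfold g.
        assert (Es : sinh (L * (arcsinh sh / L)) = sh).
        { replace (L * (arcsinh sh / L)) with (arcsinh sh) by (field; lra). apply sinh_arcsinh. }
        assert (Ec : cosh (L * (arcsinh sh / L)) = s * A / z).
        { assert (E2 := cosh_sinh_sqr (L * (arcsinh sh / L))). rewrite Es in E2.
          assert (E3 : 1 + sh ^ 2 = (s * A / z) ^ 2).
          { unfold sh.
            transitivity (1 + V ^ 2 * (s ^ 2 * A ^ 2) / (L ^ 2 * z ^ 4)); [ field; split; lra | ].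
            transitivity (s ^ 2 * A ^ 2 / z ^ 2); [ | field; lra ].
            rewrite E, hs2.
            transitivity (1 + A ^ 2 / z ^ 2 - (4 * b * A ^ 2) / L ^ 2); [ field; split; lra | ].
            rewrite HA2. field. split; lra. }
          rewrite E3 in E2. specialize (Hch (L * (arcsinh sh / L))).
          assert (0 < s * A / z).
          { replace (s * A / z) with ((s * z) * (A / z ^ 2)) by (field; lra).
            apply Rmult_lt_0_compat; trivial. apply Rdiv_lt_0_compat; trivial.
            now apply pow2_gt_0. }
          apply Rsqr_inj; try lra. unfold Rsqr. simpl in E2. lra. }
        assert (Ey : y (arcsinh sh / L) = z).
        { unfold y. rewrite Ec. field. repeat split; lra. }
        assert (EW : W (arcsinh sh / L) = V).
        { unfold W. rewrite Es, Ec. unfold sh. field. repeat split; lra. }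
        now rewrite Ey, EW.
      * intros [t <-]. split; [ now apply Vba_lift | apply Hy0 ].
    + intros eps Heps.
      (* [cosh_ge] gives [|y| (1 + |L t|) <= 2 A], and [|W| <= L |y|] gives
         [|x| <= (L + 1) / (2 a) |y|]; so [K] bounds [(|x| + |y|) (1 + |L t|)]. *)
      pose (K := 2 * A * (1 + (L + 1) / (2 * a))).
      assert (HK : 0 < K).
      { unfold K. assert (0 < (L + 1) / (2 * a)) by (apply Rdiv_lt_0_compat; lra).
        apply Rmult_lt_0_compat; lra. }
      exists (K / (L * eps)). intros t Ht.
      assert (Ht' : K < eps * (1 + Rabs (L * t))).
      { rewrite Rabs_mult, (Rabs_pos_eq L) by lra.
        apply (Rmult_lt_compat_r (L * eps)) in Ht; [ | nra ].
        replace (K / (L * eps) * (L * eps)) with K in Ht by (field; split; lra). nra. }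
      assert (Hy1 : Rabs (y t) * (1 + Rabs (L * t)) <= 2 * A).
      { unfold y. pose proof (cosh_ge (L * t)) as C. pose proof (Hch (L * t)).
        assert (hsa : Rabs s = 1) by (unfold Rabs; destruct (Rcase_abs s); nra).
        assert (Ey : Rabs (s * A / cosh (L * t)) = A / cosh (L * t)).
        { unfold Rdiv. rewrite !Rabs_mult, hsa, Rabs_inv,
            (Rabs_pos_eq A), (Rabs_pos_eq (cosh (L * t))) by lra.
          ring. }
        rewrite Ey. apply (Rmult_le_reg_r (cosh (L * t))); trivial.
        transitivity (A * (1 + Rabs (L * t))); [ apply Req_le; field; lra | ]. nra. }
      assert (HW1 : Rabs (W t) <= L * Rabs (y t)).
      { rewrite <- (Rabs_pos_eq L) at 1 by lra. rewrite <- Rabs_mult.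
        apply Rsqr_le_abs_0. unfold Rsqr.
        replace (W t * W t) with (W t ^ 2) by ring. rewrite HWD, HD.
        replace (y t ^ 4) with (y t ^ 2 * y t ^ 2) by ring.
        pose proof (pow2_ge_0 (y t * y t)). nra. }
      assert (Hx1 : Rabs ((W t + y t) / (2 * (a + y t ^ 2))) <= (L + 1) / (2 * a) * Rabs (y t)).
      { pose proof (pow2_ge_0 (y t)).
        unfold Rdiv. rewrite Rabs_mult, Rabs_inv, (Rabs_pos_eq (2 * (a + y t ^ 2))) by lra.
        transitivity (((L + 1) * Rabs (y t)) * / (2 * a)); [ | apply Req_le; ring ].
        apply Rmult_le_compat.
        - apply Rabs_pos.
        - left; apply Rinv_0_lt_compat; lra.
        - pose proof (Rabs_triang (W t) (y t)). lra.
        - apply Rinv_le_contravar; lra. }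
      eapply Rle_lt_trans; [ apply dist2_le_coords | ].
      change (Rabs ((W t + y t) / (2 * (a + y t ^ 2)) - 0) + Rabs (y t - 0) < eps).
      rewrite !Rminus_0_r.
      pose proof (Rabs_pos (L * t)) as HP.
      apply (Rmult_lt_reg_r (1 + Rabs (L * t))); [ lra | ].
      eapply Rle_lt_trans; [ | exact Ht' ].
      unfold K. assert (0 < (L + 1) / (2 * a)) by (apply Rdiv_lt_0_compat; lra).
      set (c := (L + 1) / (2 * a)) in *.
      transitivity ((1 + c) * Rabs (y t) * (1 + Rabs (L * t))).
      * apply Rmult_le_compat_r; lra.
      * rewrite Rmult_assoc, (Rmult_comm (2 * A)). apply Rmult_le_compat_l; lra.
Qed.

(** * Fixed points and linearization *)

(** Each factor of [Gba] replaces one coordinate by the other root of its quadratic, so a point is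
    fixed when both coordinates are double roots, that is, at a critical point of [Vba]. *)
Lemma Gba_fixed_iff a b p : 0 < a -> 0 < b ->
  Gba a b p = p <-> Vx a b p = 0 /\ Vy a b p = 0.
Proof.
  intros ha hb. destruct p as [x y]. unfold Gba, Gbeta, Vx, Vy; simpl fst; simpl snd.
  assert (0 < a + y ^ 2) by (pose proof (pow2_ge_0 y); lra).
  assert (0 < b + x ^ 2) by (pose proof (pow2_ge_0 x); lra).
  split.
  - intro E.
    assert (E1 : - x + y / (a + y ^ 2) = x) by exact (f_equal fst E).
    assert (E2 : - y + (- x + y / (a + y ^ 2)) / (b + (- x + y / (a + y ^ 2)) ^ 2) = y)
      by exact (f_equal snd E).
    rewrite E1 in E2.
    split.
    + transitivity (- (- x + y / (a + y ^ 2) - x) * (a + y ^ 2)); [ field; lra | rewrite E1; ring ].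
    + transitivity (- (- y + x / (b + x ^ 2) - y) * (b + x ^ 2)); [ field; lra | rewrite E2; ring ].
  - intros [E1 E2].
    assert (E3 : - x + y / (a + y ^ 2) = x).
    { apply (Rmult_eq_reg_r (a + y ^ 2)); [ | lra ].
      transitivity (- x * (a + y ^ 2) + y); [ field; lra | lra ]. }
    change ((- x + y / (a + y ^ 2),
      - y + (- x + y / (a + y ^ 2)) / (b + (- x + y / (a + y ^ 2)) ^ 2)) = (x, y)).
    rewrite E3. f_equal. apply (Rmult_eq_reg_r (b + x ^ 2)); [ | lra ].
    transitivity (- y * (b + x ^ 2) + x); [ field; lra | lra ].
Qed.

Lemma Gba_origin a b : 0 < a -> 0 < b -> Gba a b origin = origin.
Proof.
  intros ha hb. apply Gba_fixed_iff; trivial. unfold Vx, Vy, origin; simpl. split; ring.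
Qed.

Lemma Gba_fixed_unique a b p : 0 < a -> 0 < b -> / 4 <= a * b ->
  Gba a b p = p -> p = origin.
Proof.
  intros ha hb hab E. apply Gba_fixed_iff in E; trivial. destruct p as [x y].
  unfold Vx, Vy in E; simpl fst in E; simpl snd in E. destruct E as [E1 E2].
  assert (X : x = 0).
  { destruct (Req_dec x 0) as [ | Hx ]; trivial. exfalso.
    assert (0 < x ^ 2) by now apply pow2_gt_0. pose proof (pow2_ge_0 y).
    (* Eliminates the linear [y] between the two critical equations; for [a b >= 1/4] and nonzero
       [x] the second factor is positive. *)
    assert (E : x * (4 * ((a + y ^ 2) * (b + x ^ 2)) - 1) = 0).
    { transitivity (2 * (b + x ^ 2) * (2 * (a + y ^ 2) * x - y) + (2 * (b + x ^ 2) * y - x)); [ ring | ].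
      rewrite E1, E2. ring. }
    apply Rmult_integral in E. destruct E as [E | E]; [ lra | ].
    assert (0 < a * x ^ 2) by nra.
    assert (0 <= y ^ 2 * b) by nra. assert (0 <= y ^ 2 * x ^ 2) by nra.
    lra. }
  subst x. unfold origin. f_equal. lra.
Qed.

(** In [(x Vx + y Vy) / 2 - Vba] the quadratic part cancels by Euler's identity and [x ^ 2 y ^ 2]
    remains. *)
Lemma Gba_fixed_zero_level a b p : 0 < a -> 0 < b -> Vba a b p = 0 ->
  Gba a b p = p -> p = origin.
Proof.
  intros ha hb HV E. apply Gba_fixed_iff in E; trivial. destruct p as [x y].
  destruct E as [E1 E2].
  assert (Z : x * y = 0).
  { apply Rsqr_eq_0. unfold Rsqr.
    transitivity ((x * Vx a b (x, y) + y * Vy a b (x, y)) / 2 - Vba a b (x, y)).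
    - unfold Vx, Vy, Vba; simpl; field.
    - rewrite E1, E2, HV. field. }
  unfold Vx, Vy in *; simpl fst in *; simpl snd in *.
  unfold origin. apply Rmult_integral in Z. destruct Z; subst.
  - f_equal; lra.
  - f_equal; lra.
Qed.

(** The differential of [Gbeta], with [c] the derivative of [y / (beta + y ^ 2)]; its determinant is
    1. *)
Definition shear (c : R) (q : pt) : pt := (snd q, - fst q + c * snd q).

Lemma filterdiff_Gbeta beta (p : pt) : 0 < beta ->
  filterdiff (K := R_AbsRing) (U := R2)
    (V := R2)
    (Gbeta beta) (locally p) (shear ((beta - snd p ^ 2) / (beta + snd p ^ 2) ^ 2)).
Proof.
  intro hb. set (c := (beta - snd p ^ 2) / (beta + snd p ^ 2) ^ 2).
  assert (Hfst : forall F, Filter F -> filterdiff (K := R_AbsRing)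
     (U := R2) (V := R_NormedModule) fst F fst)
    by (intros; apply filterdiff_linear, (is_linear_fst (U := R_NormedModule) (V := R_NormedModule))).
  assert (Hsnd : forall F, Filter F -> filterdiff (K := R_AbsRing)
     (U := R2) (V := R_NormedModule) snd F snd)
    by (intros; apply filterdiff_linear, (is_linear_snd (U := R_NormedModule) (V := R_NormedModule))).
  assert (Hphi : is_derive (fun y => y / (beta + y ^ 2)) (snd p) c).
  { assert (0 < beta + snd p * snd p) by nra.
    unfold c. auto_derive; [ simpl; nra | ]. field. simpl; nra. }
  apply (filterdiff_comp'_2 (K := R_AbsRing)
    (T := R2) (U := R_NormedModule) (V := R_NormedModule)
    (W := R2)
    snd (fun q => - fst q + snd q / (beta + snd q ^ 2)) pair p
    snd (fun q => - fst q + c * snd q) pair).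
  - apply Hsnd, locally_filter.
  - apply (filterdiff_plus_fct (K := R_AbsRing) (V := R_NormedModule)
      (fun q => - fst q) (fun q => snd q / (beta + snd q ^ 2)) (fun q => - fst q) (fun q => c * snd q)).
    + apply (filterdiff_opp_fct (K := R_AbsRing) (V := R_NormedModule)), Hfst, locally_filter.
    + apply (filterdiff_ext_lin _ (fun q : pt => scal (snd q) c)).
      * apply (filterdiff_comp' (K := R_AbsRing)
          (U := R2) (V := R_NormedModule) (W := R_NormedModule)
          snd (fun y => y / (beta + y ^ 2)) p snd (fun u => scal u c)).
        -- apply Hsnd, locally_filter.
        -- exact Hphi.
      * intro q. apply Rmult_comm.
  - apply (filterdiff_ext (fun q => q)); [ intro q; now destruct q | ].
    apply (filterdiff_ext_lin _ (fun q => q)); [ | intro q; now destruct q ].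
    apply filterdiff_id.
Qed.

Lemma filterdiff_Gba a b p : 0 < a -> 0 < b ->
  let ca := (a - snd p ^ 2) / (a + snd p ^ 2) ^ 2 in
  let x' := snd (Gbeta a p) in
  let cb := (b - x' ^ 2) / (b + x' ^ 2) ^ 2 in
  exists l : pt -> pt, filterdiff (K := R_AbsRing)
    (U := R2)
    (V := R2) (Gba a b) (locally p) l /\
    mtrace l = ca * cb - 2 /\ mdet l = 1.
Proof.
  intros ha hb ca x' cb. exists (fun q => shear cb (shear ca q)). split; [ | split ].
  - apply (filterdiff_comp' (Gbeta a) (Gbeta b) p); now apply filterdiff_Gbeta.
  - unfold mtrace, shear; cbn [fst snd]; ring.
  - unfold mdet, shear; cbn [fst snd]; ring.
Qed.

(** The eigenvalues are [mtrace l / 2] plus or minus [i sqrt (1 - mtrace l ^ 2 / 4)]. The end values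
    2 and -2 give a double eigenvalue 1 or -1, still a conjugate pair of modulus one; the origin
    reaches 2 when [a b = 1/4]. *)
Lemma elliptic_of_trace G p l : G p = p ->
  filterdiff (K := R_AbsRing) (U := R2)
    (V := R2) G (locally p) l ->
  mdet l = 1 -> -2 <= mtrace l <= 2 -> elliptic_fixed G p.
Proof.
  intros Hp Hl Hdet Htr. split; trivial. exists l. split; trivial.
  assert (Hd : 0 <= 1 - mtrace l ^ 2 / 4) by nra.
  pose proof (sqrt_sqrt _ Hd) as Hs.
  exists (mtrace l / 2, sqrt (1 - mtrace l ^ 2 / 4)).
  set (s := sqrt (1 - mtrace l ^ 2 / 4)) in *. split.
  - unfold Cmod; simpl fst; simpl snd.
    replace (_ + _) with 1; [ apply sqrt_1 | ].
    replace (s ^ 2) with (s * s) by ring. rewrite Hs. field.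
  - intros [u v]. rewrite Hdet. set (tr := mtrace l) in *. clearbody tr s.
    unfold Cplus, Cminus, Cmult, Copp, Cplus, Cconj, RtoC; simpl. f_equal; [ | field ].
    transitivity (u * u - v * v - tr * u + (1 - tr ^ 2 / 4) + tr ^ 2 / 4); [ field | ].
    rewrite <- Hs. field.
Qed.

Lemma saddle_of_trace G p l : G p = p ->
  filterdiff (K := R_AbsRing) (U := R2)
    (V := R2) G (locally p) l ->
  mdet l = 1 -> 2 < mtrace l -> hyperbolic_saddle G p.
Proof.
  intros Hp Hl Hdet Htr. split; trivial. exists l. split; trivial.
  assert (Hd : 0 < mtrace l ^ 2 / 4 - 1) by nra.
  pose proof (sqrt_sqrt _ (Rlt_le _ _ Hd)) as Hs. pose proof (sqrt_lt_R0 _ Hd) as Hs0.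
  exists (mtrace l / 2 - sqrt (mtrace l ^ 2 / 4 - 1)), (mtrace l / 2 + sqrt (mtrace l ^ 2 / 4 - 1)).
  set (s := sqrt (mtrace l ^ 2 / 4 - 1)) in *.
  repeat apply conj.
  - apply Rabs_def1; nra.
  - rewrite Rabs_pos_eq; lra.
  - intros [u v]. rewrite Hdet. set (tr := mtrace l) in *. clearbody tr s.
    unfold Cplus, Cminus, Cmult, Copp, Cplus, Cconj, RtoC; simpl. f_equal; [ | field ].
    transitivity (u * u - v * v - tr * u + tr ^ 2 / 4 - (tr ^ 2 / 4 - 1)); [ field | ].
    rewrite <- Hs. field.
Qed.

Lemma origin_elliptic a b : 0 < a -> 0 < b -> / 4 <= a * b -> elliptic_fixed (Gba a b) origin.
Proof.
  intros ha hb hab. destruct (filterdiff_Gba a b origin ha hb) as [l [Hl [Ht Hd]]].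
  apply (elliptic_of_trace _ _ l); trivial; [ now apply Gba_origin | ].
  assert (E : mtrace l = / (a * b) - 2).
  { rewrite Ht. unfold Gbeta, origin; simpl. field. repeat split; lra. }
  rewrite E. assert (0 < / (a * b)) by (apply Rinv_0_lt_compat; lra).
  assert (/ (a * b) <= / / 4) by (apply Rinv_le_contravar; lra).
  rewrite Rinv_inv in H0. lra.
Qed.

Lemma origin_saddle a b : 0 < a -> 0 < b -> a * b < / 4 -> hyperbolic_saddle (Gba a b) origin.
Proof.
  intros ha hb hab. destruct (filterdiff_Gba a b origin ha hb) as [l [Hl [Ht Hd]]].
  apply (saddle_of_trace _ _ l); trivial; [ now apply Gba_origin | ].
  assert (E : mtrace l = / (a * b) - 2).
  { rewrite Ht. unfold Gbeta, origin; simpl. field. repeat split; lra. }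
  rewrite E. assert (/ / 4 < / (a * b)) by (apply Rinv_lt_contravar; nra).
  rewrite Rinv_inv in H. lra.
Qed.

(** Replaces the nested radicals by the two equations that annihilate the squares of
    [Vba_sum_squares]. Both radicands factor through [/ 2 - sqrt (a * b)], which is positive
    here. *)
Lemma Pfix_coords a b : 0 < a -> 0 < b -> a * b < / 4 ->
  exists x y, Pfix_plus a b = (x, y) /\ Pfix_minus a b = (- x, - y) /\ 0 < x /\ 0 < y /\
    sqrt a * x = sqrt b * y /\ x * y = / 2 - sqrt (a * b).
Proof.
  intros ha hb hab.
  destruct (sqrt_ab_lt_half a b ha hb hab) as [[K1 K2] K3].
  unfold Pfix_plus, Pfix_minus. rewrite !sqrt_div by lra. rewrite sqrt_mult in * by lra.
  assert (Ha := sqrt_sqrt a (Rlt_le _ _ ha)). assert (Hb := sqrt_sqrt b (Rlt_le _ _ hb)).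
  pose proof (sqrt_lt_R0 _ ha). pose proof (sqrt_lt_R0 _ hb).
  set (u := sqrt a) in *. set (v := sqrt b) in *. clearbody u v.
  assert (HX : - b + / 2 * (v / u) = v / u * (/ 2 - u * v)) by (rewrite <- Hb; field; lra).
  assert (HY : - a + / 2 * (u / v) = u / v * (/ 2 - u * v)) by (rewrite <- Ha; field; lra).
  rewrite HX, HY.
  assert (PX : 0 < v / u * (/ 2 - u * v)).
  { apply Rmult_lt_0_compat; [ now apply Rdiv_lt_0_compat | lra ]. }
  assert (PY : 0 < u / v * (/ 2 - u * v)).
  { apply Rmult_lt_0_compat; [ now apply Rdiv_lt_0_compat | lra ]. }
  assert (E : u * sqrt (v / u * (/ 2 - u * v)) = v * sqrt (u / v * (/ 2 - u * v))).
  { rewrite <- (sqrt_square u) at 1 by lra. rewrite <- (sqrt_square v) at 3 by lra.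
    rewrite <- !sqrt_mult by (try nra; apply Rle_0_sqr). f_equal. field. lra. }
  do 2 eexists. do 2 (split; [ reflexivity | ]).
  split; [ now apply sqrt_lt_R0 | ]. split; [ now apply sqrt_lt_R0 | ]. split; [ exact E | ].
  rewrite <- sqrt_mult by lra.
  replace (_ * _) with ((/ 2 - u * v) * (/ 2 - u * v)) by (field; lra).
  apply sqrt_square. lra.
Qed.

(** The equations give [a + y ^ 2 = u / (2 v)] and [b + x ^ 2 = v / (2 u)] for [u = sqrt a],
    [v = sqrt b], and the trace becomes [4 (1 - 4 u v) ^ 2 - 2]. They are unchanged under
    [(x, y) -> (- x, - y)], so both points are covered. *)
Lemma elliptic_critical_point a b x y : 0 < a -> 0 < b -> a * b < / 4 ->
  sqrt a * x = sqrt b * y -> x * y = / 2 - sqrt (a * b) ->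
  elliptic_fixed (Gba a b) (x, y).
Proof.
  intros ha hb hab E1 E2.
  destruct (sqrt_ab_lt_half a b ha hb hab) as [[K1 K2] K3].
  rewrite sqrt_mult in * by lra.
  assert (Ha := sqrt_sqrt a (Rlt_le _ _ ha)). assert (Hb := sqrt_sqrt b (Rlt_le _ _ hb)).
  pose proof (sqrt_lt_R0 _ ha). pose proof (sqrt_lt_R0 _ hb).
  set (u := sqrt a) in *. set (v := sqrt b) in *. clearbody u v.
  assert (EA : a + y ^ 2 = u / (2 * v)).
  { apply (Rmult_eq_reg_l v); [ | lra ].
    transitivity (v * (u * u) + y * (v * y)); [ rewrite Ha; ring | ].
    rewrite <- E1. transitivity (v * (u * u) + u * (x * y)); [ ring | ].
    rewrite E2. field. lra. }
  assert (EB : b + x ^ 2 = v / (2 * u)).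
  { apply (Rmult_eq_reg_l u); [ | lra ].
    transitivity (u * (v * v) + x * (u * x)); [ rewrite Hb; ring | ].
    rewrite E1. transitivity (u * (v * v) + v * (x * y)); [ ring | ].
    rewrite E2. field. lra. }
  assert (F : Gba a b (x, y) = (x, y)).
  { apply Gba_fixed_iff; trivial. unfold Vx, Vy; cbn [fst snd]. rewrite EA, EB. split.
    - transitivity ((u * x) / v - y); [ field; lra | rewrite E1; field; lra ].
    - transitivity ((v * y) / u - x); [ field; lra | rewrite <- E1; field; lra ]. }
  destruct (filterdiff_Gba a b (x, y) ha hb) as [l [Hl [Ht Hd]]].
  apply (elliptic_of_trace _ _ l); trivial.
  (* The chain rule evaluates the second differential at [Gbeta a (x, y)], whose second coordinate
     is [x] because the point is fixed. *)
  assert (Ex : snd (Gbeta a (x, y)) = x) by exact (f_equal fst F).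
  rewrite Ex in Ht. cbn [snd] in Ht.
  assert (Et : mtrace l = 4 * (1 - 4 * (u * v)) ^ 2 - 2).
  { rewrite Ht. rewrite EA, EB.
    replace (y ^ 2) with (u / (2 * v) - u * u) by (rewrite <- EA, <- Ha; ring).
    replace (x ^ 2) with (v / (2 * u) - v * v) by (rewrite <- EB, <- Hb; ring).
    rewrite <- Ha, <- Hb. field. lra. }
  rewrite Et. assert (-1 <= 1 - 4 * (u * v) <= 1) by lra.
  set (z := 1 - 4 * (u * v)) in *. clearbody z. split; nra.
Qed.

Lemma Vba_critical_point a b x y : 0 < a -> 0 < b ->
  sqrt a * x = sqrt b * y -> x * y = / 2 - sqrt (a * b) -> Vba a b (x, y) = hmin a b.
Proof.
  intros ha hb E1 E2. rewrite Vba_sum_squares by assumption. cbn [fst snd].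
  rewrite E1, E2. ring.
Qed.

(** * Surrounding *)

Lemma level_far a b h : 0 < a -> 0 < b ->
  exists M, forall q, M <= dist2 q origin -> h < Vba a b q.
Proof.
  intros ha hb. destruct (level_bounded a b h ha hb) as [K HK].
  exists (2 * K + 1). intros q Hq. apply Rnot_le_lt. intro H.
  destruct (HK q H) as [H1 H2]. pose proof (dist2_le_coords q origin) as D.
  unfold origin in *. cbn [fst snd] in D. rewrite !Rminus_0_r in D. lra.
Qed.

Lemma continuity_Vba a b sigma : cont_curve sigma -> continuity (fun t => Vba a b (sigma t)).
Proof.
  intros [Hx Hy].
  assert (Hc : forall c : R, continuity (fun _ => c)) by (intro c; now apply continuity_const).
  assert (H2 : forall f : R -> R, continuity f -> continuity (fun t => f t ^ 2)).
  { intros f Hf. simpl. repeat apply continuity_mult; trivial. }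
  unfold Vba.
  apply (continuity_plus (fun t => _ - _)); [ | apply (continuity_mult (fun t => _ ^ 2)); now apply H2 ].
  apply (continuity_minus (fun t => _ + _)); [ | now apply continuity_mult ].
  apply (continuity_plus (fun t => _ * _)); apply (continuity_mult (fun _ => _)); auto.
Qed.

(** A path from [p] to a far point takes [f] from a negative to a nonnegative value, so it crosses a
    zero of [f]. *)
Lemma surrounds_pt_of_sign (f : pt -> R) (S : pt -> Prop) (p : pt) M :
  (forall sigma, cont_curve sigma -> continuity (fun t => f (sigma t))) ->
  f p < 0 -> (forall q, M <= dist2 q origin -> 0 <= f q) -> (forall q, f q = 0 -> S q) ->
  ~ S p -> surrounds_pt S p.
Proof.
  intros Hc Hp HM HS Hn. split; trivial. exists M. intros sigma Hs H0 H1.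
  destruct (IVT_gen (fun t => f (sigma t)) 0 1 0) as [t [Ht Ft]].
  - now apply Hc.
  - rewrite H0. specialize (HM _ H1). rewrite Rmin_left, Rmax_right; lra.
  - exists t. rewrite Rmin_left, Rmax_right in Ht by lra. auto.
Qed.

Lemma level_surrounds a b h p : 0 < a -> 0 < b -> Vba a b p < h ->
  surrounds_pt (level a b h) p.
Proof.
  intros ha hb Hp. destruct (level_far a b h ha hb) as [M HM].
  apply (surrounds_pt_of_sign (fun q => Vba a b q - h) _ p M).
  - intros s Hs. apply (continuity_minus (fun t => _) (fun _ => h)).
    + now apply continuity_Vba.
    + now apply continuity_const.
  - lra.
  - intros q Hq. specialize (HM q Hq). lra.
  - intros q Hq. unfold level. lra.
  - unfold level. lra.
Qed.

(** The region [Vba < h], [s y > 0] is where [f] below is negative. Its boundary avoids the line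
    [y = 0], where [Vba = a x ^ 2 >= 0 > h], so every zero of [f] is on the half level. *)
Lemma half_level_surrounds a b h s p : 0 < a -> 0 < b -> h < 0 ->
  Vba a b p < h -> 0 < s * snd p -> surrounds_pt (half_level a b h s) p.
Proof.
  intros ha hb hh Hp Hs. destruct (level_far a b h ha hb) as [M HM].
  (* [f] is twice the maximum of [Vba - h] and [- s y]. *)
  pose (f := fun q : pt => Vba a b q - h + - s * snd q + Rabs (Vba a b q - h - - s * snd q)).
  apply (surrounds_pt_of_sign f _ p M).
  - intros sg Hsg.
    assert (C1 : continuity (fun t => Vba a b (sg t) - h)).
    { apply (continuity_minus (fun t => _) (fun _ => h)).
      + now apply continuity_Vba.
      + now apply continuity_const. }
    assert (C2 : continuity (fun t => - s * snd (sg t))).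
    { apply (continuity_mult (fun _ => - s)); [ now apply continuity_const | apply Hsg ]. }
    apply (continuity_plus (fun t => _ + _)).
    + now apply (continuity_plus (fun t => _)).
    + apply (continuity_comp (fun t => Vba a b (sg t) - h - - s * snd (sg t)) Rabs).
      * now apply (continuity_minus (fun t => _ - _)).
      * apply Rcontinuity_abs.
  - unfold f, Rabs. destruct (Rcase_abs _); lra.
  - intros q Hq. specialize (HM q Hq). unfold f, Rabs. destruct (Rcase_abs _); lra.
  - intros q Hq.
    assert (H : (Vba a b q = h /\ 0 <= s * snd q) \/ (s * snd q = 0 /\ Vba a b q <= h)).
    { unfold f, Rabs in Hq. destruct (Rcase_abs _); lra. }
    assert (Hy : s * snd q <> 0).
    { intro Z. apply Rmult_integral in Z. destruct Z as [-> | Z]; [ lra | ].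
      assert (Vba a b q = a * fst q ^ 2) by (unfold Vba; rewrite Z; ring).
      pose proof (pow2_ge_0 (fst q)). assert (0 <= a * fst q ^ 2) by nra. lra. }
    split; lra.
  - intros [H _]. lra.
Qed.

(** * Stable and unstable sets *)

Lemma nonpos_level_halves a b p : 0 < a -> 0 < b -> Vba a b p <= 0 -> p <> origin ->
  half_level a b (Vba a b p) 1 p \/ half_level a b (Vba a b p) (-1) p.
Proof.
  intros ha hb HV Hp. unfold half_level.
  destruct (Rtotal_order (snd p) 0) as [H | [H | H]]; [ right | | left ]; try (split; lra).
  exfalso. apply Hp. destruct p as [x y]. cbn [snd] in H. subst y.
  assert (E : Vba a b (x, 0) = a * x ^ 2) by (unfold Vba; cbn [fst snd]; ring).
  assert (Hx : x = 0).
  { destruct (Req_dec x 0) as [ | Hx ]; trivial.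
    apply pow2_gt_0 in Hx. nra. }
  now rewrite Hx.
Qed.

Lemma Nat_iter_shift (G : pt -> pt) (g : R -> pt) tau :
  (forall t, G (g t) = g (t + tau)) -> forall n t, Nat.iter n G (g t) = g (t + INR n * tau).
Proof.
  intros H n t. induction n as [ | n IH ].
  - simpl. f_equal. ring.
  - rewrite Nat.iter_succ, IH, H, S_INR. f_equal. ring.
Qed.

(** The sign of [tau] is not known, but [|t + n tau| >= n |tau| - |t|] and [g] tends to the origin
    at both ends. Used with [tau] for the stable set and [- tau] for the unstable one. *)
Lemma shift_tends_to_origin g tau t eps : tends_to_origin g -> tau <> 0 -> 0 < eps ->
  exists N, forall n, (N <= n)%nat -> dist2 (g (t + INR n * tau)) origin < eps.
Proof.
  intros Hg Htau Heps. destruct (Hg eps Heps) as [T HT].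
  pose proof (Rabs_pos_lt _ Htau) as Hp.
  destruct (INR_unbounded ((T + Rabs t) / Rabs tau)) as [N HN].
  exists N. intros n Hn. apply HT. apply le_INR in Hn.
  assert (E : T + Rabs t < INR n * Rabs tau).
  { apply (Rmult_lt_reg_r (/ Rabs tau)); [ now apply Rinv_0_lt_compat | ].
    rewrite Rmult_assoc, Rinv_r, Rmult_1_r by lra. unfold Rdiv in HN. lra. }
  pose proof (Rabs_triang (t + INR n * tau) (- t)) as Tr.
  replace (t + INR n * tau + - t) with (INR n * tau) in Tr by ring.
  rewrite Rabs_Ropp, Rabs_mult, (Rabs_pos_eq (INR n)) in Tr by apply pos_INR. lra.
Qed.

Lemma zero_half_level_homoclinic a b s p : 0 < a -> 0 < b -> a * b < / 4 -> s * s = 1 ->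
  half_level a b 0 s p ->
  stable_set (Gba a b) origin p /\ unstable_set (Gba a b) origin p.
Proof.
  intros ha hb hab hs Hp.
  destruct (homoclinic_orbit a b s ha hb hab hs) as [g [Hg [_ [_ [Him Hlim]]]]].
  destruct (Gba_orbit_shift a b 1 0 g (half_level a b 0 s)) as [tau Htau]; trivial.
  { now intros q [H _]. }
  { apply half_level_invariant; trivial; lra. }
  assert (Hne : tau <> 0).
  { intros ->. assert (HS : half_level a b 0 s (g 0)) by (apply Him; now exists 0).
    destruct HS as [H1 H2].
    assert (E : g 0 = origin).
    { apply (Gba_fixed_zero_level a b); trivial. rewrite Htau. f_equal. ring. }
    rewrite E in H2. unfold origin in H2. cbn [snd] in H2. lra. }
  apply Him in Hp. destruct Hp as [t <-]. split.
  - intros eps Heps.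
    destruct (shift_tends_to_origin g tau t eps Hlim Hne Heps) as [N HN].
    exists N. intros n Hn. rewrite (Nat_iter_shift _ _ _ Htau). now apply HN.
  - exists (fun n => g (t + INR n * - tau)). split; [ simpl; f_equal; ring | split ].
    + intro n. rewrite Htau, S_INR. f_equal. ring.
    + intros eps Heps. apply shift_tends_to_origin; trivial. lra.
Qed.

Lemma Vba_near_origin a b q d : 0 < a -> 0 < b -> d <= 1 -> dist2 q origin < d ->
  Rabs (Vba a b q) <= (a + b + 2) * d.
Proof.
  intros ha hb Hd Hq. destruct (coord_le_dist2 q origin) as [H1 H2].
  destruct q as [x y]. unfold origin in *. cbn [fst snd] in *. rewrite Rminus_0_r in *.
  assert (Hx : Rabs x <= d) by lra. assert (Hy : Rabs y <= d) by lra.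
  pose proof (Rabs_pos x). pose proof (Rabs_pos y).
  assert (Hd0 : d * d <= d) by nra.
  assert (Hxx : x ^ 2 <= d) by (rewrite <- pow2_abs; nra).
  assert (Hyy : y ^ 2 <= d) by (rewrite <- pow2_abs; nra).
  assert (Hxy : Rabs (x * y) <= d) by (rewrite Rabs_mult; nra).
  assert (Hxxyy : 0 <= x ^ 2 * y ^ 2 <= d).
  { pose proof (pow2_ge_0 x). pose proof (pow2_ge_0 y). split; nra. }
  pose proof (pow2_ge_0 x). pose proof (pow2_ge_0 y).
  assert (0 <= a * x ^ 2 <= a * d) by nra. assert (0 <= b * y ^ 2 <= b * d) by nra.
  apply Rabs_le_between in Hxy.
  apply Rabs_le_between. unfold Vba; cbn [fst snd]. split; lra.
Qed.

Lemma Vba_zero_of_limit a b v (s : nat -> pt) : 0 < a -> 0 < b ->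
  (forall n, Vba a b (s n) = v) ->
  (forall eps, 0 < eps -> exists N, forall n, (N <= n)%nat -> dist2 (s n) origin < eps) ->
  v = 0.
Proof.
  intros ha hb Hv Hs. destruct (Req_dec v 0) as [ | Hne ]; trivial. exfalso.
  apply Rabs_pos_lt in Hne.
  (* Within this distance of the origin [|Vba|] is at most [|v| / 2], contradicting
     [|Vba| = |v|]. *)
  pose (d := Rmin 1 (Rabs v / (2 * (a + b + 2)))).
  assert (Hd : 0 < d) by (apply Rmin_glb_lt; [ lra | apply Rdiv_lt_0_compat; lra ]).
  destruct (Hs d Hd) as [N HN].
  pose proof (Vba_near_origin a b (s N) d ha hb (Rmin_l _ _) (HN N (le_n N))) as H.
  rewrite Hv in H.
  assert (H2 : (a + b + 2) * d <= (a + b + 2) * (Rabs v / (2 * (a + b + 2)))).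
  { apply Rmult_le_compat_l; [ lra | apply Rmin_r ]. }
  replace ((a + b + 2) * (Rabs v / (2 * (a + b + 2)))) with (Rabs v / 2) in H2 by (field; lra).
  lra.
Qed.

Lemma zero_level_stable_unstable a b p : 0 < a -> 0 < b -> a * b < / 4 -> p <> origin ->
  (Vba a b p = 0 <-> stable_set (Gba a b) origin p) /\
  (Vba a b p = 0 <-> unstable_set (Gba a b) origin p).
Proof.
  intros ha hb hab Hp.
  assert (H0 : Vba a b p = 0 -> stable_set (Gba a b) origin p /\ unstable_set (Gba a b) origin p).
  { intro HV. destruct (nonpos_level_halves a b p) as [H | H]; trivial; try lra;
      rewrite HV in H; eapply zero_half_level_homoclinic; eauto; ring. }
  split; split; try (intro; now apply H0).
  - intro H. apply (Vba_zero_of_limit a b _ (fun n => Nat.iter n (Gba a b) p)); trivial.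
    intro n. induction n as [ | n IH ]; trivial.
    rewrite Nat.iter_succ, Vba_Gba; trivial.
  (* [s] is a backward orbit, so invariance of [Vba] is read from [s (S n)] to its image [s n]. *)
  - intros [s [S0 [SG SL]]]. apply (Vba_zero_of_limit a b _ s); trivial.
    intro n. induction n as [ | n IH ]; [ now rewrite S0 | ].
    now rewrite <- IH, <- (SG n), Vba_Gba.
Qed.

Lemma zero_half_level_line a b s : 0 < a -> 0 < b -> a * b < / 4 -> s * s = 1 ->
  diffeo_line (half_level a b 0 s) /\ conj_translation (Gba a b) (half_level a b 0 s).
Proof.
  intros ha hb hab hs.
  destruct (homoclinic_orbit a b s ha hb hab hs) as [g [Hg [Hinj [Hinv [Him _]]]]].
  apply (orbit_line a b 1 0 g); trivial.
  - now intros q [H _].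
  - apply half_level_invariant; trivial; lra.
Qed.

(** * Assembling the phase portrait *)

Lemma half_level_disjoint a b h p : ~ (half_level a b h 1 p /\ half_level a b h (-1) p).
Proof. intros [[_ H1] [_ H2]]. lra. Qed.

Theorem theorem2 (a b : R) (ha : 0 < a) (hb : 0 < b) :
  (a * b >= / 4 ->
     (forall p : pt, Gba a b p = p <-> p = origin) /\
     elliptic_fixed (Gba a b) origin /\
     (forall h, 0 < h ->
        surrounds (level a b h) (fun p => p = origin) /\
        diffeo_circle (level a b h) /\
        invariant (Gba a b) (level a b h) /\
        conj_rotation (Gba a b) (level a b h)))
  /\
  (a * b < / 4 ->
     (* (i) *)
     (hyperbolic_saddle (Gba a b) origin /\
      (forall p, p <> origin ->
         (Vba a b p = 0 <-> stable_set (Gba a b) origin p)) /\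
      (forall p, p <> origin ->
         (Vba a b p = 0 <-> unstable_set (Gba a b) origin p)) /\
      exists C1 C2 : pt -> Prop,
        (forall p, (Vba a b p = 0 /\ p <> origin) <-> (C1 p \/ C2 p)) /\
        (forall p, ~ (C1 p /\ C2 p)) /\
        diffeo_line C1 /\ diffeo_line C2 /\
        invariant (Gba a b) C1 /\ invariant (Gba a b) C2 /\
        conj_translation (Gba a b) C1 /\ conj_translation (Gba a b) C2) /\
     (* (ii) *)
     (forall h, 0 < h ->
        diffeo_circle (level a b h) /\
        surrounds (level a b h) (fun p => Vba a b p <= 0) /\
        invariant (Gba a b) (level a b h) /\
        conj_rotation (Gba a b) (level a b h)) /\
     (* (iii) *)
     elliptic_fixed (Gba a b) (Pfix_plus a b) /\
     elliptic_fixed (Gba a b) (Pfix_minus a b) /\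
     (* (iv) *)
     (forall h, h < 0 -> h <> hmin a b -> (exists p, level a b h p) ->
        exists C1 C2 : pt -> Prop,
          (forall p, level a b h p <-> (C1 p \/ C2 p)) /\
          (forall p, ~ (C1 p /\ C2 p)) /\
          diffeo_circle C1 /\ diffeo_circle C2 /\
          surrounds C1 (fun p => p = Pfix_plus a b) /\
          surrounds C2 (fun p => p = Pfix_minus a b) /\
          invariant (Gba a b) C1 /\ invariant (Gba a b) C2 /\
          conj_rotation (Gba a b) C1 /\ conj_rotation (Gba a b) C2)).
Proof.
  assert (hsq : -1 * -1 = 1) by ring. assert (hsq1 : 1 * 1 = 1) by ring.
  split.
  - intro hab. apply Rge_le in hab. split; [ | split ].
    + intro p. split; [ now apply Gba_fixed_unique | intros ->; now apply Gba_origin ].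
    + now apply origin_elliptic.
    + intros h hh. destruct (positive_level_circle a b h ha hb hh) as [H1 H2].
      split; [ | split; [ | split ] ]; trivial.
      * intros p ->. apply level_surrounds; trivial.
        unfold Vba, origin; cbn [fst snd]. nra.
      * now apply level_invariant.
  - intro hab. split; [ | split; [ | split; [ | split ] ] ].
    + split; [ | split; [ | split ] ].
      * now apply origin_saddle.
      * intros p Hp. now apply zero_level_stable_unstable.
      * intros p Hp. now apply zero_level_stable_unstable.
      * exists (half_level a b 0 1), (half_level a b 0 (-1)).
        destruct (zero_half_level_line a b 1 ha hb hab hsq1).
        destruct (zero_half_level_line a b (-1) ha hb hab hsq).
        split; [ | repeat (split; [ first [ assumption | apply half_level_disjoint
          | apply half_level_invariant; trivial; lra ] | ]); trivial ].
        intro p. split.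
        -- intros [HV Hp]. rewrite <- HV. apply nonpos_level_halves; trivial. lra.
        -- intros [[HV Hs] | [HV Hs]]; split; trivial; intros ->;
             unfold origin in Hs; cbn [snd] in Hs; lra.
    + intros h hh. destruct (positive_level_circle a b h ha hb hh) as [H1 H2].
      split; [ | split; [ | split ] ]; trivial.
      * intros p Hp. apply level_surrounds; trivial. lra.
      * now apply level_invariant.
    + destruct (Pfix_coords a b ha hb hab) as [x [y [-> [_ [_ [_ [E1 E2]]]]]]].
      now apply elliptic_critical_point.
    + destruct (Pfix_coords a b ha hb hab) as [x [y [_ [-> [_ [_ [E1 E2]]]]]]].
      apply elliptic_critical_point; trivial; lra.
    + intros h hh Hne [p0 Hp0].
      (* A point on the level excludes [h < hmin], and [h = hmin] is excluded by assumption. *)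
      assert (hlt : hmin a b < h).
      { pose proof (hmin_le a b p0 ha hb) as H. unfold level in Hp0. lra. }
      exists (half_level a b h 1), (half_level a b h (-1)).
      destruct (negative_half_level_circle a b h 1 ha hb hab hlt hh hsq1).
      destruct (negative_half_level_circle a b h (-1) ha hb hab hlt hh hsq).
      destruct (Pfix_coords a b ha hb hab) as [x [y [Ep [Em [_ [Hy [E1 E2]]]]]]].
      split.
      { intro p. split.
        - intro HV. unfold level in HV. rewrite <- HV. apply nonpos_level_halves; trivial; [ lra | ].
          intros ->. unfold Vba, origin in HV; cbn [fst snd] in HV. lra.
        - now intros [[HV _] | [HV _]]. }
      split; [ apply half_level_disjoint | ]. do 2 (split; trivial).
      split.
      { intros p ->. rewrite Ep. apply half_level_surrounds; trivial.
        - now rewrite Vba_critical_point.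
        - cbn [snd]. lra. }
      split.
      { intros p ->. rewrite Em. apply half_level_surrounds; trivial.
        - rewrite Vba_critical_point; trivial; lra.
        - cbn [snd]. lra. }
      do 2 (split; [ apply half_level_invariant; trivial; lra | ]). now split.
Qed.
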